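(* Let $\lambda$ be a partition with at most $n$ parts. (i) If $\eta\in UGC_\lambda(n)$, then $\pi:=\Pi_\lambda[\Delta_\lambda(\eta)]\in S_n^{\lambda\text{-}312}$ and $s_\lambda(\eta;x)\equiv d_\lambda(\pi;x)$ (i.e. $\mathcal{S}_\lambda(\eta)=\mathcal{D}_\lambda(\pi)$). (ii) If $\pi\in S_n^{\lambda\text{-}312}$, then $\gamma:=\Psi_\lambda(\pi)\in UG_\lambda(n)$ and $d_\lambda(\pi;x)\equiv s_\lambda(\gamma;x)$. (iii) Every flag Schur polynomial $s_\lambda(\varphi;x)$, $\varphi\in UF_\lambda(n)$, is identical (as a generating function) to a uniquely determined Demazure polynomial $d_\lambda(\pi;x)$, $\pi\in S_n^\lambda$, and every Demazure polynomial $d_\lambda(\pi;x)$ with $\pi\in S_n^{\lambda\text{-}312}$ is identical to a uniquely determined flag Schur polynomial.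
   Context: Fix $n\ge1$, $[n]=\{1,\dots,n\}$, variables $x_1,\dots,x_n$. A partition $\lambda=(\lambda_1\ge\dots\ge\lambda_n\ge0)$; box $(j,i)$ of its shape is in column $j$, row $i$. $R_\lambda\subseteq[n-1]$ is the set of distinct column lengths of $\lambda$ less than $n$, written $q_1<\dots<q_r$, $q_0:=0$, $q_{r+1}:=n$; carrels are $(q_{h-1},q_h]$, $h\in[r+1]$. $\lambda$-tuples: $n$-tuples with entries in $[n]$; upper if $\beta_i\ge i$. $U_\lambda(n)$ upper ones; $UF_\lambda(n)$ weakly increasing upper ones; $UI_\lambda(n)$ upper ones strictly increasing on each carrel. Critical indices of $\beta\in U_\lambda(n)$: in carrel $h$ put $x_1:=q_h$; recursively $x_u$ is the largest index with $q_{h-1}<x_u<x_{u-1}$ and $\beta_{x_{u-1}}-\beta_{x_u}>x_{u-1}-x_u$, stopping when none exists; critical entries $\beta_{x_u}$. $\Delta_\lambda(\beta)_i:=\beta_x-(x-i)$, $x$ the smallest critical index $\ge i$ in the carrel of $i$. $UGC_\lambda(n)$: $\beta$ whose critical entries, listed by increasing critical index, weakly increase; $UG_\lambda(n):=UGC_\lambda(n)\cap UI_\lambda(n)$. $S_n^\lambda$: permutations $\pi$ of $[n]$ increasing on each carrel; $B_h:=\{\pi_1,\dots,\pi_{q_h}\}$. $\pi\in S_n^{\lambda\text{-}312}$ if there are no $h\in[r-1]$ and $a\le q_h<b\le q_{h+1}<c$ with $\pi_a>\pi_c>\pi_b$. $\Psi_\lambda(\pi)=\psi$: for $i$ in carrel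 $h$, $\psi_i$ is the $(q_h-i+1)$-th largest element of $B_h$. For $\gamma\in UG_\lambda(n)$, $\Pi_\lambda(\gamma)=\pi$: $\pi_i:=\gamma_i$ on $(0,q_1]$; for $h=1,\dots,r$ in turn, $s:=\gamma_{q_h}-\gamma_{q_h+1}+1$ if $\gamma_{q_h}>\gamma_{q_h+1}$, else $s:=0$; $\pi_i:=\gamma_i$ for $i\in(q_h+s,q_{h+1}]$; for $i\in(q_h,q_h+s]$, $\pi_i$ is the $(q_h+s-i+1)$-th largest element of $\{1,\dots,\gamma_{q_h}\}\setminus\{\pi_1,\dots,\pi_{q_h}\}$. $\mathcal{T}_\lambda$: semistandard tableaux of shape $\lambda$ with entries in $[n]$, ordered entrywise; content $\Theta(T)$ counts entries equal to each $i$; weight $x^{\Theta(T)}$. $\mathcal{S}_\lambda(\beta):=\{T:T_j(i)\le\beta_i\ \forall (j,i)\}$, $s_\lambda(\beta;x):=\sum_{T\in\mathcal{S}_\lambda(\beta)}x^{\Theta(T)}$; flag Schur polynomial when $\beta\in UF_\lambda(n)$. $\lambda$-key $Y_\lambda(\pi)$: tableau of shape $\lambda$ whose columns of length $q_h$ have entry set $B_h$ and columns of length $n$ have entry set $[n]$. $\mathcal{D}_\lambda(\pi):=\{T:K_+(T)\le Y_\lambda(\pi)\}$, $K_+(T)$ the Lascoux–Schützenberger right key; $d_\lambda(\pi;x):=\sum_{T\in\mathcal{D}_\lambda(\pi)}x^{\Theta(T)}$. Two weight-sum polynomials are identical ($\equiv$) if their underlying tableau sets are equal.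
   Formalization: In the definition of Π_λ, s = γ_{q_h} − γ_{q_h+1} + 1 is used when γ_{q_h} ≥ γ_{q_h+1}, not only when γ_{q_h} > γ_{q_h+1}; with the strict inequality (i) fails for n = 2, λ = (1,0), η = (2,2), where π = (2,2) is not a permutation. *)

(* Defs.v *)
From mathcomp Require Import all_boot all_order all_algebra.
From mathcomp Require Import mpoly.

Set Implicit Arguments.
Unset Strict Implicit.
Unset Printing Implicit Defensive.

(* Tuples, rows of tableaux and words are indexed from 1: [s \_ i] is the i-th
   entry of [s], meaningful only for 1 <= i <= size s (in particular [s \_ 0]
   is junk).  All tuples have natural-number entries, and "entries in [n]"
   means entries between 1 and n. *)
Definition ent (s : seq nat) (i : nat) : nat := nth 0 s i.-1.
Notation "s \_ i" := (ent s i) (at level 30, no associativity).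

Definition kth_largest (k : nat) (s : seq nat) : nat := (sort geq s) \_ k.

Section Lambda.
Variables (n : nat) (lam : n.-tuple nat).

Definition is_partition : Prop := sorted geq lam.

Definition ncols : nat := lam \_ 1.

Definition collen (j : nat) : nat := count (leq j) lam.

Definition Rset : seq nat :=
  [seq q <- iota 1 n.-1 | has (fun j => collen j == q) (iota 1 ncols)].

Definition r : nat := size Rset.

(* q 0 = 0, then the elements of R_lambda in increasing order, then
   q (r + 1) = n. *)
Definition q (h : nat) : nat := nth n (0 :: Rset) h.

(* The h in [r + 1] with q (h - 1) < i <= q h. *)
Definition carrel (i : nat) : nat := (find (leq i) Rset).+1.

Definition incr_on_carrels (b : n.-tuple nat) : Prop :=
  forall i j, 1 <= i -> i < j -> j <= n ->
    carrel i = carrel j -> b \_ i < b \_ j.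

Definition lam_tuple (b : n.-tuple nat) : Prop :=
  forall i, 1 <= i <= n -> 1 <= b \_ i <= n.

Definition U (b : n.-tuple nat) : Prop :=
  lam_tuple b /\ forall i, 1 <= i <= n -> i <= b \_ i.

Definition UF (b : n.-tuple nat) : Prop := U b /\ sorted leq b.

Definition UI (b : n.-tuple nat) : Prop := U b /\ incr_on_carrels b.

(* The indices y with lo < y < x and b_x - b_y > x - y; the last inequality,
   between integers, is written without truncated subtraction of entries. *)
Definition crit_candidates (b : seq nat) (lo x : nat) : seq nat :=
  [seq y <- iota lo.+1 (x.-1 - lo) | b \_ y + (x - y) < b \_ x].

(* x = x_u, followed by x_(u+1), x_(u+2), etc.; at most [fuel] further indices
   are produced, and [fuel = n] is always enough since they decrease. *)
Fixpoint crit_chain (fuel : nat) (b : seq nat) (lo x : nat) : seq nat :=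
  x :: if fuel is fuel'.+1 then
         if crit_candidates b lo x is y :: ys
         then crit_chain fuel' b lo (last y ys) else [::]
       else [::].

Definition carrel_crits (b : seq nat) (h : nat) : seq nat :=
  rev (crit_chain n b (q h.-1) (q h)).

Definition crits (b : seq nat) : seq nat :=
  flatten [seq carrel_crits b h | h <- iota 1 r.+1].

Definition Delta (b : n.-tuple nat) : n.-tuple nat :=
  [tuple (let i := (val k).+1 in
          let x := head 0 [seq x <- carrel_crits b (carrel i) | i <= x] in
          b \_ x - (x - i)) | k < n].

Definition UGC (b : n.-tuple nat) : Prop :=
  U b /\ sorted leq [seq b \_ x | x <- crits b].

Definition UG (b : n.-tuple nat) : Prop := UGC b /\ UI b.

(* Permutations are in one-line notation. *)
Definition Slam (p : n.-tuple nat) : Prop :=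
  perm_eq p (iota 1 n) /\ incr_on_carrels p.

Definition avoids312 (p : n.-tuple nat) : Prop :=
  ~ exists h a b c,
      [/\ 1 <= h < r, 1 <= a <= q h, q h < b <= q h.+1, q h.+1 < c <= n
        & p \_ b < p \_ c < p \_ a].

Definition Slam312 (p : n.-tuple nat) : Prop := Slam p /\ avoids312 p.

Definition Bset (p : n.-tuple nat) (h : nat) : seq nat := take (q h) p.

Definition Psi (p : n.-tuple nat) : n.-tuple nat :=
  [tuple (let i := (val k).+1 in let h := carrel i in
          kth_largest (q h - i + 1) (Bset p h)) | k < n].

(* [Pi_prefix g h] is pi_1, ..., pi_(q (h + 1)).  When g_(q h) = g_(q h + 1)
   one has s = 1 rather than s = 0: otherwise the value would be repeated in
   pi, as already happens for n = 2, lam = (1, 0), g = (2, 2). *)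
Fixpoint Pi_prefix (g : seq nat) (h : nat) : seq nat :=
  if h is h'.+1 then
    let p := Pi_prefix g h' in
    let qh := q h in
    let s := if g \_ qh.+1 <= g \_ qh then g \_ qh - g \_ qh.+1 + 1 else 0 in
    let pool := [seq x <- iota 1 (g \_ qh) | x \notin p] in
    p ++ [seq if i <= qh + s then kth_largest (qh + s - i + 1) pool else g \_ i
         | i <- iota qh.+1 (q h.+1 - qh)]
  else [seq g \_ i | i <- iota 1 (q 1)].

Definition Pi (g : n.-tuple nat) : n.-tuple nat :=
  [tuple nth 0 (Pi_prefix g r) k | k < n].

(* [T (j, i)] is the entry in column j+1 and row i+1; it is 0 exactly outside
   the shape of lam. *)
Definition filling := {ffun 'I_ncols * 'I_n -> 'I_n.+1}.

Definition in_shape (j : 'I_ncols) (i : 'I_n) : bool := i < collen j.+1.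

Definition semistandard (T : filling) : bool :=
  [&& [forall j, forall i, in_shape j i == (0 < T (j, i))],
      [forall j, forall i : 'I_n, forall i' : 'I_n,
         (i < i') && in_shape j i' ==> (T (j, i) < T (j, i'))]
    & [forall j : 'I_ncols, forall j' : 'I_ncols, forall i,
         (j < j') && in_shape j' i ==> (T (j, i) <= T (j', i))]].

Definition tableaux : {set filling} := [set T | semistandard T].

Definition tab_le (T T' : filling) : bool := [forall b, T b <= T' b].

Definition col (T : filling) (j : 'I_ncols) : seq nat :=
  [seq val (T (j, i)) | i <- enum 'I_n & in_shape j i].

Definition of_cols (C : 'I_ncols -> seq nat) : filling :=
  [ffun b : 'I_ncols * 'I_n => inord (nth 0 (C b.1) b.2)].

Definition content (T : filling) : 'X_{1..n} :=
  [multinom #|[set b | T b == i.+1 :> nat]| | i < n].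

(* A weight-sum polynomial remembers the tableaux it sums over, which is what
   [identical] compares. *)
Record weight_sum := WeightSum { support : {set filling} }.

Definition weight_poly (f : weight_sum) : {mpoly int[n]} :=
  (\sum_(T in support f) 'X_[content T])%R.

Definition identical (f g : weight_sum) : Prop := support f = support g.

Definition Sset (b : n.-tuple nat) : {set filling} :=
  [set T in tableaux |
    [forall j, forall i, in_shape j i ==> (T (j, i) <= b \_ i.+1)]].

Definition s_lam (b : n.-tuple nat) : weight_sum := WeightSum (Sset b).

(* The lengths q of the columns are the [q h], for which [take q p] is
   [Bset p h], and possibly n, for which it is a rearrangement of [n]. *)
Definition Ykey (p : n.-tuple nat) : filling :=
  of_cols (fun j => sort leq (take (collen j.+1) p)).

(* Jeu de taquin on a skew tableau with two columns, read downwards: [B]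
   occupies the rows 1, ..., size B of the right column and [A] the rows
   d+1, ..., d + size A of the left one.  A hole opened under [B] moves up
   along the right column as long as the entry above it is at least the entry
   to its left; [exit_row] is the row where the left entry moves into it
   instead, after which the hole moves up to the top of the left column. *)
Fixpoint exit_row (d : nat) (A B : seq nat) (row : nat) : nat :=
  if row is row'.+1 then
    if (row' == 0) || (B \_ row' < A \_ (row - d)) then row
    else exit_row d A B row'
  else 0.

Definition jdt_slide (d : nat) (AB : seq nat * seq nat) : seq nat * seq nat :=
  let: (A, B) := AB in
  let row := exit_row d A B (size B).+1 in
  (take (row - d).-1 A ++ drop (row - d) A,
   take row.-1 B ++ A \_ (row - d) :: drop row.-1 B).

(* Exchanges the lengths of two adjacent columns with size B <= size A. *)
Definition jdt_exchange (A B : seq nat) : seq nat * seq nat :=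
  iteri (size A - size B) jdt_slide (A, B).

(* The Lascoux-Schuetzenberger right key: its column j is the rightmost column
   of a skew tableau that rectifies to T, whose column lengths are a
   rearrangement of those of T, and whose rightmost column is as long as the
   column j of T.  The skew tableau is obtained by exchanging column j
   successively with each of the columns on its right. *)
Definition right_key_col (T : filling) (j : 'I_ncols) : seq nat :=
  foldl (fun C D => (jdt_exchange C D).2) (col T j)
        [seq col T k | k : 'I_ncols <- enum 'I_ncols & j < k].

Definition right_key (T : filling) : filling := of_cols (right_key_col T).

Definition Dset (p : n.-tuple nat) : {set filling} :=
  [set T in tableaux | tab_le (right_key T) (Ykey p)].

Definition d_lam (p : n.-tuple nat) : weight_sum := WeightSum (Dset p).

End Lambda.

(* Main.v *)
Require Import Defs.
From mathcomp Require Import all_boot all_order all_algebra.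
From mathcomp Require Import mpoly zify.

Set Implicit Arguments.
Unset Strict Implicit.
Unset Printing Implicit Defensive.

(* Let b_h be B_h in increasing order. Exchanging a column A with a shorter
   column D on its right produces a right column C with A <= C <= D that
   contains D and in which every entry either belongs to D or is the entry of A
   in the same row. If pi avoids 312, then B_h contains all the numbers between
   an entry of B_h \ B_h' and a larger entry of B_h', for h' < h. At the largest
   row where C (for columns A <= b_h and D <= b_h') exceeds b_h, its entry lies
   strictly between two consecutive entries of b_h, which this property of pi
   excludes. Hence T <= Y(pi) implies K_+(T) <= Y(pi), and conversely since
   T <= K_+(T). The same argument shows that T <= Y(pi) amounts to the row
   bounds Psi(pi), so S(Psi(pi)) = D(pi). Since Y(pi) is the largest right key
   in D(pi), pi is determined by D(pi). The tuples eta and Delta(eta) bound the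
   same tableaux because columns are strict, and Psi(Pi(Delta(eta))) =
   Delta(eta) as the numbers that Pi inserts below the maximum of B_h fill
   all the gaps between the first entry of Delta(eta) on the next carrel and that
   maximum. *)

(** * Strictly increasing sequences and entrywise comparison of columns *)

Lemma mem_nat_nth (s : seq nat) y :
  y \in s -> exists2 i, i < size s & nth 0 s i = y.
Proof. by move/(nthP 0). Qed.

Lemma nat_mem_nth (s : seq nat) i : i < size s -> nth 0 s i \in s.
Proof. exact: mem_nth. Qed.

Lemma uniq_nat_leq_size (s t : seq nat) :
  uniq s -> {subset s <= t} -> size s <= size t.
Proof. exact: uniq_leq_size. Qed.

Lemma ltn_sorted_nth s i j :
  sorted ltn s -> i < j -> j < size s -> nth 0 s i < nth 0 s j.
Proof.
move=> ss ij js; apply: (sorted_ltn_nth ltn_trans) => //.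
by rewrite inE (ltn_trans ij).
Qed.

Lemma ltn_sorted_leq_nth s i j :
  sorted ltn s -> i <= j -> j < size s -> nth 0 s i <= nth 0 s j.
Proof.
by move=> ss; rewrite leq_eqVlt => /predU1P[-> //|ij js]; rewrite ltnW ?ltn_sorted_nth.
Qed.

Lemma ltn_sorted_nth_inv s i j :
  sorted ltn s -> nth 0 s i < nth 0 s j -> i < size s -> i < j.
Proof.
move=> ss lt_ij i_s; rewrite ltnNge; apply/negP => ji.
by have := ltn_sorted_leq_nth ss ji i_s; rewrite leqNgt lt_ij.
Qed.

Lemma ltn_sorted_uniq s : sorted ltn s -> uniq s.
Proof. exact: (sorted_uniq ltn_trans ltnn). Qed.

Lemma sort_ltn_sorted s : uniq s -> sorted ltn (sort leq s).
Proof.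
by move=> us; rewrite ltn_sorted_uniq_leq sort_uniq us sort_sorted //; apply: leq_total.
Qed.

Lemma ltn_sorted_eq s t : sorted ltn s -> sorted ltn t -> s =i t -> s = t.
Proof. exact: (irr_sorted_eq ltn_trans ltnn). Qed.

(** Pigeonhole: if the entry of [t] were smaller, the first [i.+1] entries of [t] would be distinct
    members of [s] found among its first [i] entries. *)
Lemma ltn_sorted_subset_nth s t i :
  sorted ltn s -> sorted ltn t -> {subset t <= s} -> i < size t ->
  nth 0 s i <= nth 0 t i.
Proof.
move=> ss st ts it; rewrite leqNgt; apply/negP => lt_ts.
have /(uniq_nat_leq_size (take_uniq i.+1 (ltn_sorted_uniq st))) :
    {subset take i.+1 t <= take i s}.
  move=> y /mem_nat_nth[k]; rewrite size_take_min => kl <-{y}.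
  rewrite nth_take; last lia.
  have kt : nth 0 t k \in s by apply/ts/nat_mem_nth; lia.
  rewrite -(nth_index 0 kt).
  have lt_ki : index (nth 0 t k) s < i.
    apply: (ltn_sorted_nth_inv ss); rewrite ?index_mem ?nth_index //.
    apply: leq_ltn_trans lt_ts.
    by apply: ltn_sorted_leq_nth => //; lia.
  have lis : index (nth 0 t k) s < size (take i s).
    by rewrite size_take_min leq_min lt_ki index_mem.
  by rewrite -(nth_take 0 lt_ki) nat_mem_nth.
by rewrite !size_take_min; lia.
Qed.

Lemma ltn_sorted_drop_mem s k y z :
  sorted ltn s -> z \in drop k s -> y \in s -> z < y -> y \in drop k s.
Proof.
move=> ss /mem_nat_nth[i]; rewrite size_drop nth_drop => il <-.
move=> /mem_nat_nth[j js <-] /(ltn_sorted_nth_inv ss) ij.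
have kij : k + i < j by apply: ij; lia.
have -> : j = k + (j - k) by lia.
by rewrite -nth_drop nat_mem_nth // size_drop; lia.
Qed.

(** The row condition for a column [A] to the left of a possibly shorter column [D]; for equal
    lengths it is the entrywise order used to compare with keys. *)
Definition col_le (A D : seq nat) : Prop :=
  size D <= size A /\ forall i, i < size D -> nth 0 A i <= nth 0 D i.

Lemma col_le_trans A B C : col_le A B -> col_le B C -> col_le A C.
Proof.
move=> [sAB AB] [sBC BC]; split=> [|i iC]; first exact: leq_trans sAB.
by apply: leq_trans (BC i iC); apply/AB/(leq_trans iC).
Qed.

Lemma col_le_subset s t :
  sorted ltn s -> sorted ltn t -> {subset t <= s} -> col_le s t.
Proof.
move=> ss st ts; split; first exact: uniq_nat_leq_size (ltn_sorted_uniq st) ts.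
by move=> i; apply: ltn_sorted_subset_nth.
Qed.

(* At the largest index where [C] exceeds [b], the entry of [C] lies strictly
   between two consecutive entries of [b]. *)
Lemma col_le_gap b C :
  sorted ltn b -> sorted ltn C -> size C = size b ->
  (forall i, i < size b -> nth 0 b i < nth 0 C i -> nth 0 C i \in b) ->
  col_le C b.
Proof.
move=> sb sC sz H; split=> [|i ib]; first by rewrite sz.
have [m] := ubnP (size b - i); elim: m i ib => // m IH i ib lm.
rewrite leqNgt; apply/negP => lt_i; have /mem_nat_nth[k kb ek] := H i ib lt_i.
have ik : i < k by apply: (ltn_sorted_nth_inv sb); rewrite ?ek.
have i1 : i.+1 < size b by lia.
have := ltn_sorted_nth sC (leqnn i.+1); rewrite sz => /(_ i1).
have := IH i.+1 i1; have := ltn_sorted_leq_nth sb ik kb; lia.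
Qed.

(** * Jeu de taquin on two columns *)

Section Exchange.

(** The scan climbs from [row]. The exit test succeeds at row [k.+1], so the hole leaves there or
    lower down, and every row it climbs past has failed the test. *)
Lemma exit_rowP d A B k row :
  k < row -> (k == 0) || (B \_ k < A \_ (k.+1 - d)) ->
  let e := exit_row d A B row in
  [/\ k < e <= row, (e.-1 == 0) || (B \_ e.-1 < A \_ (e - d))
    & forall m, e <= m -> m < row -> A \_ (m.+1 - d) <= B \_ m].
Proof.
elim: row => // row IH k_row k_ok /=.
case: ifPn => [ok|]; first by split=> [|//|m]; lia.
rewrite negb_or -leqNgt => /andP[row0 le_row].
have [k_eq|k_lt] : k = row \/ k < row by lia.
  by move: k_ok; rewrite k_eq (negPf row0) ltnNge le_row.
have [e_row e_ok e_le] := IH k_lt k_ok; split=> //; first by lia.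
move=> m em; rewrite ltnS leq_eqVlt => /predU1P[-> //|]; exact: e_le.
Qed.

Variables A0 D : seq nat.
Hypotheses (A0s : sorted ltn A0) (Ds : sorted ltn D) (A0D : col_le A0 D).

(* [k] is the row of the last exit: exit rows increase, so that the left column
   still agrees with [A0] below row [k]. *)
Definition exchange_inv (d k : nat) (AB : seq nat * seq nat) : Prop :=
  let: (A, B) := AB in
  [/\ [/\ size A = size A0 - d, size B = size D + d & d <= k <= size B],
      drop (k - d) A = drop k A0,
      sorted ltn B /\ {subset D <= B},
      k = 0 \/ nth 0 B k.-1 = nth 0 A0 k.-1
    & forall i, i < size B -> nth 0 A0 i <= nth 0 B i /\
        (nth 0 B i \in D \/ i < k /\ nth 0 B i = nth 0 A0 i)].

Lemma exchange_inv0 : exchange_inv 0 0 (A0, D).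
Proof.
split; rewrite ?subn0 ?addn0 ?drop0 //; [by split | by left |]. 
by move=> i iD; split; [apply: A0D.2 | left; apply: nat_mem_nth].
Qed.

(** The entry [x] that crosses comes from the part of the left column still equal to [A0], hence
    keeps its row. The entries of [B] below it shift down by one row; they lie past row [k], so they
    belong to [D]. *)
Lemma exchange_inv_slide d k AB :
  d < size A0 - size D -> exchange_inv d k AB ->
  exists k', exchange_inv d.+1 k' (jdt_slide d AB).
Proof.
case: AB => A B dlt [[sA sB dk] AA0 [Bs DB] Bk Bi].
have AE row : k < row -> A \_ (row - d) = nth 0 A0 row.-1.
  move=> krow; rewrite /ent; have -> : (row - d).-1 = (k - d) + (row.-1 - k) by lia.
  by rewrite -nth_drop AA0 nth_drop; congr nth; lia.
have k_lt : k < (size B).+1 by lia.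
(* In row [k], the last exit, the right column holds the entry of [A0], which is smaller than the
   left entry one row down. So this slide exits strictly below row [k]. *)
have k_ok : (k == 0) || (B \_ k < A \_ (k.+1 - d)).
  case: Bk => [->//|Bk]; rewrite AE // /ent Bk.
  case: (posnP k) => [->//|k0]; apply/orP; right.
  by apply: ltn_sorted_nth => //; lia.
rewrite /jdt_slide; have [e_k e_ok e_le] := exit_rowP k_lt k_ok.
set e := exit_row _ _ _ _ in e_k e_ok e_le *.
exists e; rewrite AE; last by lia.
set x := nth 0 A0 e.-1.
set B' := take e.-1 B ++ x :: drop e.-1 B.
have B'E i : nth 0 B' i =
    if i < e.-1 then nth 0 B i else if i == e.-1 then x else nth 0 B i.-1.
  rewrite nth_cat size_takel; last by lia.
  case: ltnP => [ie|ei]; first by rewrite nth_take.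
  case: eqP => [->|ne]; first by rewrite subnn.
  by rewrite (_ : i - e.-1 = (i.-1 - e.-1).+1) /= ?nth_drop; [congr nth|]; lia.
have sB' : size B' = (size B).+1.
  by rewrite size_cat /= size_drop size_takel; lia.
have x_gt i : i < e.-1 -> nth 0 B i < x.
  move=> ie; case/orP: e_ok; first by lia.
  rewrite AE; last by lia.
  by apply: leq_ltn_trans; apply: ltn_sorted_leq_nth => //; lia.
(* The failed exit tests say that an entry moved down one row still dominates [A0] in its new
   row. *)
have x_lt i : e.-1 <= i -> i < size B -> nth 0 A0 i.+1 <= nth 0 B i.
  move=> ei iB; have := e_le i.+1; rewrite AE; last by lia.
  by apply; lia.
split=> //.
- split; rewrite ?sB' ?sA ?sB; [|lia|lia].
  by rewrite size_cat size_drop size_takel; lia.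
- have -> : drop (e - d.+1) (take (e - d).-1 A ++ drop (e - d) A) = drop (e - d) A.
    rewrite drop_size_cat // size_takel; lia.
  have -> : e - d = (e - k) + (k - d) by lia.
  by rewrite -drop_drop AA0 drop_drop; congr drop; lia.
- split; last first.
    move=> y /DB; rewrite -{1}(cat_take_drop e.-1 B) !mem_cat inE.
    by case/orP => ->; rewrite ?orbT.
  apply/(sortedP 0) => i; rewrite sB' !B'E => iB.
  have [ie|ie|ie] := ltngtP i.+1 e.-1.
  + apply: ltn_sorted_nth => //; lia.
  + case: eqP => [ei|ne].
      apply: leq_trans (x_lt i _ _); try lia.
      by rewrite /x ei; apply: ltn_sorted_nth => //; lia.
    by apply: ltn_sorted_nth => //=; lia.
  + by apply: x_gt; lia.
- by right; rewrite B'E ltnn eqxx.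
move=> i; rewrite sB' B'E => iB.
case: ltnP => [ie|ei].
  have [] := Bi i; first by lia.
  by move=> le_i H; split=> //; case: H => [|[? ?]]; [left|right; split=> //; lia].
case: eqP => [->|ne]; first by split=> //; right; split=> //; lia.
have [] := Bi i.-1; first by lia.
move=> _ H; split.
  by have := x_lt i.-1; rewrite prednK; [apply|]; lia.
by case: H => [|[]]; [left|lia].
Qed.

(** The invariant after all [size A0 - size D] slides. The later arguments rely on these five
    properties instead of an explicit description of the exchanged column. *)
Lemma jdt_exchangeP (C := (jdt_exchange A0 D).2) :
  [/\ size C = size A0, sorted ltn C, {subset D <= C}, col_le A0 C
    & forall i, i < size C -> nth 0 C i \in D \/ nth 0 C i = nth 0 A0 i].
Proof.
have inv m : m <= size A0 - size D ->
    exists k, exchange_inv m k (iteri m jdt_slide (A0, D)).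
  elim: m => [|m IH] lm; first by exists 0; apply: exchange_inv0.
  have [k inv] := IH (ltnW lm); exact: exchange_inv_slide lm inv.
have [k] := inv _ (leqnn _); rewrite /C /jdt_exchange.
case: (iteri _ _ _) => A B [[_ sB _] _ [Bs DB] _ Bi] /=.
have sBA : size B = size A0 by rewrite sB subnKC // A0D.1.
split=> //; first by split=> [|i /Bi[]//]; rewrite sBA.
by move=> i /Bi[_ [|[]]]; [left|right].
Qed.

(** Since the new column lies below [D], it satisfies the row condition with the columns right of
    [D], and exchanges can be iterated. *)
Lemma jdt_exchange_le : col_le (jdt_exchange A0 D).2 D.
Proof.
have [sC Cs DC _ _] := jdt_exchangeP; exact: col_le_subset.
Qed.

End Exchange.

(* For the sets [b'] = B_h' and [b] = B_h with h' <= h, this is what avoiding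
   312 means; see [avoids312_gapless]. *)
Definition gapless (b' b : seq nat) : Prop :=
  forall x y z, x \in b' -> y \notin b -> z \in b -> z < y -> y < x -> z \in b'.

(** The entries of [b] up to index [i] are all below the gap [y], itself below [x], so [gapless]
    puts them in [b']; a subset has the larger entries at each rank. *)
Lemma gapless_rank b' b x y i :
  sorted ltn b' -> sorted ltn b -> gapless b' b -> x \in b' -> y \notin b ->
  y < x -> i < size b -> nth 0 b i < y ->
  i < size b' /\ nth 0 b' i <= nth 0 b i.
Proof.
move=> sb' sb gap xb' yb yx ib bi_y.
have sub : {subset take i.+1 b <= b'}.
  move=> z /mem_nat_nth[k]; rewrite size_take_min => kl <-{z}.
  rewrite nth_take; last lia.
  have kb : k < size b by lia.
  apply: (gap x y) => //; first exact: nat_mem_nth.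
  by apply: leq_ltn_trans bi_y; apply: ltn_sorted_leq_nth => //; lia.
have st : sorted ltn (take i.+1 b) by apply: take_sorted.
have szt : size (take i.+1 b) = i.+1 by rewrite size_takel.
split; first by have := uniq_nat_leq_size (ltn_sorted_uniq st) sub; rewrite szt.
by have := ltn_sorted_subset_nth sb' st sub (i := i); rewrite szt nth_take //; apply.
Qed.

(** Where the new column exceeds [b], its entry is not that of [A], hence lies in [D]; outside [b]
    the last hypothesis would bound it by [b] after all. That hypothesis is stated abstractly to
    cover both gapless sets and the case of [D] contained in [b]. *)
Lemma jdt_exchange_bound A D b :
  sorted ltn A -> sorted ltn D -> col_le A D ->
  sorted ltn b -> size A = size b -> col_le A b ->
  (forall i y, i < size b -> y \in D -> y \notin b -> nth 0 b i < y ->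
     i < size D /\ nth 0 D i <= nth 0 b i) ->
  col_le (jdt_exchange A D).2 b.
Proof.
move=> As Ds AD sb szb Ab H; have [sC Cs _ _ CE] := jdt_exchangeP As Ds AD.
apply: col_le_gap => //; first by rewrite sC.
move=> i ib lt_i; have [|CD|CA] := CE i; first by rewrite sC szb.
  apply: contraLR lt_i => Cb; rewrite -leqNgt leqNgt; apply/negP => lt_i.
  have [iD Di] := H _ _ ib CD Cb lt_i.
  have := (jdt_exchange_le As Ds AD).2 i iD; lia.
by have := Ab.2 i ib; rewrite -CA leqNgt lt_i.
Qed.

(** An entry [y] of [D] outside [b] is strictly below the entry of [b'] in its row, which serves as
    the [x] of [gapless_rank]. *)
Lemma jdt_exchange_gapless A D b b' :
  sorted ltn A -> sorted ltn D -> col_le A D ->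
  sorted ltn b -> size A = size b -> col_le A b ->
  sorted ltn b' -> size D = size b' -> col_le D b' ->
  {subset b' <= b} -> gapless b' b ->
  col_le (jdt_exchange A D).2 b.
Proof.
move=> As Ds AD sb szA Ab sb' szD Db' sub gap.
apply: jdt_exchange_bound => // i y ib /mem_nat_nth[j jD <-{y}] yb lt_i.
have jb' : j < size b' by rewrite -szD.
have xb' := nat_mem_nth jb'.
have le_j := Db'.2 j jb'.
have ne_j : nth 0 D j != nth 0 b' j by apply: contraNneq yb => ->; apply: sub.
have lt_j : nth 0 D j < nth 0 b' j by rewrite ltn_neqAle ne_j.
have [ib' le_i] := gapless_rank sb' sb gap xb' yb lt_j ib lt_i.
by split; [rewrite szD | apply: leq_trans (Db'.2 i ib') le_i].
Qed.

(** The set [b'] may change with the row, as [Psi] reads its [i]-th entry from the key of the carrel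
    of [i]. An entry of [C] above [b] and outside it would be a gap below [b'], and [gapless_rank]
    refutes this. *)
Lemma col_le_gapless C b :
  sorted ltn C -> sorted ltn b -> size C = size b ->
  (forall i, i < size b -> exists b',
     [/\ sorted ltn b', {subset b' <= b}, gapless b' b, i < size b'
       & nth 0 C i <= nth 0 b' i]) ->
  col_le C b.
Proof.
move=> Cs sb szC H; apply: col_le_gap => // i ib lt_i.
have [b' [sb' sub gap ib' le_i]] := H i ib.
apply: contraLR lt_i => Cb; rewrite -leqNgt leqNgt; apply/negP => lt_i.
have xb' := nat_mem_nth ib'.
have ne_i : nth 0 C i != nth 0 b' i by apply: contraNneq Cb => ->; apply: sub.
have lt_i' : nth 0 C i < nth 0 b' i by rewrite ltn_neqAle ne_i.
have [_] := gapless_rank sb' sb gap xb' Cb lt_i' ib lt_i; lia.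
Qed.

(** Induction principle for right key columns: an invariant need only survive one exchange, with the
    row condition against the next column available. *)
Lemma foldl_exchange m (F : 'I_m -> seq nat) (Inv : seq nat -> Prop) ks C :
  (forall k, sorted ltn (F k)) ->
  (forall k k' : 'I_m, k < k' -> col_le (F k) (F k')) ->
  pairwise (fun k k' : 'I_m => k < k') ks ->
  sorted ltn C -> (forall k, k \in ks -> col_le C (F k)) ->
  (forall A k, k \in ks -> sorted ltn A -> size A = size C ->
     col_le A (F k) -> Inv A -> Inv (jdt_exchange A (F k)).2) ->
  Inv C ->
  let R := foldl (fun C D => (jdt_exchange C D).2) C [seq F k | k <- ks] in
  [/\ sorted ltn R, size R = size C & Inv R].
Proof.
move=> Fs Fle; elim: ks C => [|k ks IH] C //= /andP[/allP lt_k ksP] Cs CF HI HC.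
have CFk : col_le C (F k) by apply: CF; rewrite mem_head.
have [sC' C's _ _ _] := jdt_exchangeP Cs (Fs k) CFk.
rewrite -sC'; apply: IH => //.
- move=> k' k'ks; apply: col_le_trans (jdt_exchange_le Cs (Fs k) CFk) _.
  exact/Fle/lt_k.
- move=> A k' k'ks As sA; apply: HI => //; first by rewrite inE k'ks orbT.
  by rewrite sA sC'.
- by apply: HI => //; rewrite mem_head.
Qed.

(** * Carrels and column lengths *)

Section Shape.

Variables (n : nat) (lam : n.-tuple nat).
Hypothesis n_gt0 : 0 < n.

Local Notation q := (q lam).
Local Notation r := (r lam).
Local Notation carrel := (carrel lam).
Local Notation collen := (collen lam).

Lemma Rset_sorted : sorted ltn (Rset lam).
Proof. by apply: sorted_filter; [apply: ltn_trans | apply: iota_ltn_sorted]. Qed.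

Lemma Rset_bound x : x \in Rset lam -> 0 < x < n.
Proof. by rewrite mem_filter mem_iota => /andP[_]; lia. Qed.

Lemma q0 : q 0 = 0. Proof. by []. Qed.

Lemma q_last : q r.+1 = n.
Proof. by rewrite /Defs.q nth_default. Qed.

Lemma q_Rset h : h < r -> q h.+1 = nth 0 (Rset lam) h.
Proof. by move=> hr; rewrite /Defs.q /=; apply: set_nth_default. Qed.

Lemma q_lt h h' : h < h' -> h' <= r.+1 -> q h < q h'.
Proof.
case: h' => // h'; rewrite !ltnS leq_eqVlt => hh'; rewrite leq_eqVlt => hr.
have Rn k : k < r -> 0 < nth 0 (Rset lam) k < n by move=> kr; apply/Rset_bound/mem_nth.
case/predU1P: hr => [hr|hr].
  subst h'.
  case/predU1P: hh' => [hh'|hh']; last first.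
    by case: h hh' => [|h] hh'; rewrite q_last // q_Rset; [have := Rn h|]; lia.
  rewrite q_last; case: h hh' => // h hh'; rewrite q_Rset; [have := Rn h|]; lia.
rewrite (q_Rset hr); case: h hh' => [|h] hh'; first by have := Rn _ hr; rewrite q0; lia.
rewrite q_Rset; last by lia.
by apply: ltn_sorted_nth Rset_sorted _ _; [lia|].
Qed.

Lemma q_le h h' : h <= h' -> h' <= r.+1 -> q h <= q h'.
Proof. by rewrite leq_eqVlt => /predU1P[->//|hh'] hr; apply/ltnW/q_lt. Qed.

Lemma q_le_n h : h <= r.+1 -> q h <= n.
Proof. by move=> hr; apply: leq_trans (q_le hr (leqnn _)) _; rewrite q_last. Qed.

Lemma q_gt0 h : 0 < h -> h <= r.+1 -> 0 < q h.
Proof. by move=> h0 hr; have := q_lt h0 hr. Qed.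

Lemma carrelP i : 0 < i <= n ->
  [/\ 0 < carrel i <= r.+1, q (carrel i).-1 < i & i <= q (carrel i)].
Proof.
move=> /andP[i0 i_n]; rewrite /Defs.carrel /=.
have f_r : find (leq i) (Rset lam) <= r by apply: find_size.
split; first by lia.
  case E : (find _ _) => [|f] //; rewrite q_Rset; last by rewrite -E.
  rewrite ltnNge; apply/negP => le.
  by have := @before_find _ 0 (leq i) (Rset lam) f; rewrite E ltnSn le => /(_ isT).
(* If no element of [Rset] reaches [i], [find] returns [r]: the carrel is the last one, ending at
   [n]. *)
case: (ltnP (find (leq i) (Rset lam)) r) => [lt|ge].
  by rewrite q_Rset // nth_find // has_find.
by rewrite (_ : find _ _ = r) ?q_last //; lia.
Qed.

Lemma carrel_eq i h : 0 < h <= r.+1 -> q h.-1 < i <= q h -> carrel i = h.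
Proof.
move=> /andP[h0 hr] /andP[lo hi].
have [] := @carrelP i; first by have := q_le_n hr; lia.
move=> /andP[c0 cr] clo chi.
have [lt|lt|//] := ltngtP (carrel i) h.
  by have := @q_le (carrel i) h.-1; lia.
by have := @q_le h (carrel i).-1; lia.
Qed.

Lemma carrel_le i j : 0 < i -> i <= j -> j <= n -> carrel i <= carrel j.
Proof.
move=> i0 ij jn; have [] := @carrelP i; first lia; have [] := @carrelP j; first lia.
move=> /andP[j1 j2] j3 j4 /andP[i1 i2] i3 i4; rewrite leqNgt; apply/negP => lt.
have := @q_le (carrel j) (carrel i).-1; lia.
Qed.

Lemma leq_carrel i h : 0 < i -> h <= r.+1 -> (i <= q h) = (0 < i <= n) && (carrel i <= h).
Proof.
move=> i0 hr; apply/idP/idP => [iq|/andP[/carrelP[c cl ch] ih]].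
  have i_n : 0 < i <= n by have := q_le_n hr; lia.
  rewrite i_n /= leqNgt; apply/negP => lt; have [c cl ch] := carrelP i_n.
  have := @q_le h (carrel i).-1; lia.
by apply: leq_trans ch _; apply: q_le.
Qed.

Lemma collen_le_n j : collen j <= n.
Proof. by have := count_size (leq j) lam; rewrite size_tuple. Qed.

Lemma collen_anti j j' : j <= j' -> collen j' <= collen j.
Proof. by move=> jj'; apply: sub_count => x /=; apply: leq_trans. Qed.

Lemma collen_gt0 j : j <= ncols lam -> 0 < collen j.
Proof.
move=> jn; rewrite -has_count; apply/hasP; exists (lam \_ 1) => //.
by apply: mem_nth; rewrite size_tuple.
Qed.

Lemma collen_q (j : 'I_(ncols lam)) : exists2 h, 0 < h <= r.+1 & collen j.+1 = q h.
Proof.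
have [jn|jn] := eqVneq (collen j.+1) n; first by exists r.+1; rewrite ?q_last //=.
have jR : collen j.+1 \in Rset lam.
  rewrite mem_filter mem_iota; apply/andP; split.
    by apply/hasP; exists j.+1; rewrite ?eqxx // mem_iota; have := ltn_ord j; lia.
  have := collen_le_n j.+1; have := @collen_gt0 j.+1 (ltn_ord j); lia.
have iR : index (collen j.+1) (Rset lam) < r by rewrite index_mem.
by exists (index (collen j.+1) (Rset lam)).+1; rewrite ?q_Rset ?nth_index //; lia.
Qed.

(** The index [r.+1] is excluded because the shape need not have a column of length [n]. *)
Lemma q_collen h : 0 < h <= r -> exists j : 'I_(ncols lam), collen j.+1 = q h.
Proof.
case: h => // h hr; have : q h.+1 \in Rset lam by rewrite q_Rset // mem_nth.
rewrite mem_filter => /andP[/hasP[j]]; rewrite mem_iota => jn /eqP <- _.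
have jn' : j.-1 < ncols lam by lia.
by exists (Ordinal jn'); rewrite /= prednK //; lia.
Qed.

End Shape.

(** * Tableaux and right keys *)

Section Columns.

Variables (n : nat) (lam : n.-tuple nat).

Local Notation collen := (collen lam).
Local Notation ncols := (ncols lam).
Local Notation col := Defs.col.

Lemma val_filter_enum_ord c : c <= n ->
  [seq val i | i : 'I_n <- enum 'I_n & i < c] = iota 0 c.
Proof.
move=> cn; rewrite -(filter_map val (fun x => x < c)) val_enum_ord.
apply: ltn_sorted_eq; rewrite ?iota_ltn_sorted //.
  by apply: sorted_filter; [apply: ltn_trans | apply: iota_ltn_sorted].
by move=> x; rewrite mem_filter !mem_iota /=; lia.
Qed.

Lemma size_col (T : filling lam) (j : 'I_ncols) : size (col T j) = collen j.+1.
Proof.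
by rewrite size_map -(size_map val) val_filter_enum_ord ?size_iota ?collen_le_n.
Qed.

Lemma nth_col (T : filling lam) (j : 'I_ncols) (i : 'I_n) :
  i < collen j.+1 -> nth 0 (col T j) i = T (j, i).
Proof.
move=> ic; have cn := collen_le_n lam j.+1.
have E := val_filter_enum_ord cn.
have sz : i < size [seq k : 'I_n <- enum 'I_n | k < collen j.+1].
  by rewrite -(size_map val) E size_iota.
rewrite /Defs.col (nth_map i) //; congr (val (T (_, _))); apply: val_inj => /=.
by rewrite -(nth_map i 0 val sz) E nth_iota.
Qed.

Lemma nth_col_ord (T : filling lam) (j : 'I_ncols) i (ic : i < collen j.+1) :
  nth 0 (col T j) i = T (j, Ordinal (leq_trans ic (collen_le_n lam j.+1))).
Proof. by rewrite -nth_col. Qed.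

Lemma mem_col_le (T : filling lam) (j : 'I_ncols) y : y \in col T j -> y <= n.
Proof. by case/mapP => i _ ->; rewrite -ltnS ltn_ord. Qed.

Lemma tableauxP (T : filling lam) : T \in tableaux lam ->
  [/\ forall j, sorted ltn (col T j), forall j y, y \in col T j -> 0 < y
    & forall j j' : 'I_ncols, j < j' -> col_le (col T j) (col T j')].
Proof.
rewrite inE => /and3P[/forallP pos /forallP cols /forallP rows]; split.
- move=> j; apply/(sortedP 0) => i; rewrite size_col => ic.
  have ic' := ltnW ic; rewrite !nth_col_ord.
  set i1 := Ordinal _; set i2 := Ordinal _.
  move/forallP: (cols j) => /(_ i1)/forallP/(_ i2)/implyP; apply.
  by rewrite /= ltnSn /in_shape.
- move=> j y /mem_nat_nth[i]; rewrite size_col => ic <-.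
  rewrite nth_col_ord; set i1 := Ordinal _.
  have /forallP/(_ i1)/eqP pos_i := pos j.
  by rewrite -pos_i /in_shape.
move=> j j' jj'; split; first by rewrite !size_col collen_anti // ltnW.
move=> i; rewrite size_col => ic'.
have ic : i < collen j.+1 by apply: leq_trans ic' (collen_anti _ _); apply: ltnW.
have [i0 ei] : exists i0 : 'I_n, i0 = i :> nat.
  by exists (Ordinal (leq_trans ic (collen_le_n lam j.+1))).
subst i; rewrite !nth_col //; move/forallP: (rows j) => /(_ j')/forallP/(_ i0)/implyP.
by apply; rewrite jj' /in_shape.
Qed.

Lemma SsetP (b : n.-tuple nat) (T : filling lam) :
  reflect (T \in tableaux lam /\
           forall (j : 'I_ncols) i, i < collen j.+1 -> nth 0 (col T j) i <= b \_ i.+1)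
          (T \in Sset lam b).
Proof.
rewrite [T \in Sset _ _]inE; apply: (iffP andP) => -[TT H]; split=> //.
  move=> j i ic; rewrite nth_col_ord.
  set k := Ordinal _; have /forallP/(_ j)/forallP/(_ k)/implyP := H; exact.
apply/forallP => j; apply/forallP => i; apply/implyP => ij.
by rewrite -nth_col // H.
Qed.

(** The bound makes [inord] faithful; past the end of the column the default [0] is the code for a
    box outside the shape. *)
Lemma val_of_cols (C : 'I_ncols -> seq nat) (j : 'I_ncols) (i : 'I_n) :
  all (fun y => y <= n) (C j) -> of_cols C (j, i) = nth 0 (C j) i :> nat.
Proof.
move=> /allP Cn; rewrite ffunE inordK //= ltnS.
case: (ltnP i (size (C j))) => [iC|?]; last by rewrite nth_default.
by apply: Cn; apply: mem_nth.
Qed.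

Lemma pairwise_filter_enum_ord m (a : pred 'I_m) :
  pairwise (fun k k' : 'I_m => k < k') [seq k <- enum 'I_m | a k].
Proof.
apply: pairwise_filter; have := iota_ltn_sorted 0 m.
by rewrite (sorted_pairwise ltn_trans) -val_enum_ord pairwise_map.
Qed.

(** An exchange only raises the left column and takes its entries from the two columns, whence T <=
    K_+(T) and the bound [n]. *)
Lemma right_key_colP (T : filling lam) (j : 'I_ncols) : T \in tableaux lam ->
  [/\ sorted ltn (right_key_col T j), size (right_key_col T j) = collen j.+1,
      all (fun y => y <= n) (right_key_col T j)
    & col_le (col T j) (right_key_col T j)].
Proof.
move=> /tableauxP[Ts _ Tle].
have ksP := pairwise_filter_enum_ord (fun k : 'I_ncols => j < k).
have := @foldl_exchange _ (col T)
  (fun C => all (fun y => y <= n) C /\ col_le (col T j) C) _ (col T j) Ts Tle ksP (Ts j).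
case.
- by move=> k; rewrite mem_filter => /andP[jk _]; apply: Tle.
- move=> A k _ As sA AT [/allP An TA].
  have [sC Cs DC AC CE] := jdt_exchangeP As (Ts k) AT.
  split; last exact: col_le_trans TA AC.
  apply/allP => y /mem_nat_nth[i iC <-].
  case: (CE i iC) => [|->]; first exact: mem_col_le.
  by apply/An/nat_mem_nth; rewrite -sC.
- split; last by split.
  by apply/allP => y; apply: mem_col_le.
by move=> Rs; rewrite size_col => sR [Rn RT].
Qed.

Lemma right_key_col_inv (T : filling lam) (j : 'I_ncols) (b : seq nat) : T \in tableaux lam ->
  size b = collen j.+1 -> col_le (col T j) b ->
  (forall A (k : 'I_ncols), j < k -> sorted ltn A -> size A = size b ->
     col_le A (col T k) -> col_le A b -> col_le (jdt_exchange A (col T k)).2 b) ->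
  col_le (right_key_col T j) b.
Proof.
move=> /tableauxP[Ts _ Tle] sb Tb H.
have ksP := pairwise_filter_enum_ord (fun k : 'I_ncols => j < k).
have := @foldl_exchange _ (col T)
  (fun C => col_le C b) _ (col T j) Ts Tle ksP (Ts j).
case=> //.
- by move=> k; rewrite mem_filter => /andP[jk _]; apply: Tle.
move=> A k; rewrite mem_filter => /andP[jk _] As; rewrite size_col -sb => sA.
exact: H.
Qed.

(* [key p (q h)] is B_h in increasing order, that is, a column of the key of [p]. *)
Definition key (p : seq nat) (c : nat) : seq nat := sort leq (take c p).

Lemma mem_key p c : key p c =i take c p.
Proof. exact: mem_sort. Qed.

Section Permutation.

Variable p : n.-tuple nat.
Hypothesis pP : perm_eq p (iota 1 n).

Lemma mem_perm_iota y : (y \in (p : seq nat)) = (0 < y <= n).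
Proof. by rewrite (perm_mem pP) mem_iota add1n ltnS. Qed.

Lemma uniq_perm_iota : uniq p.
Proof. by rewrite (perm_uniq pP) iota_uniq. Qed.

Lemma key_sorted c : sorted ltn (key p c).
Proof. by apply/sort_ltn_sorted/take_uniq/uniq_perm_iota. Qed.

Lemma size_key c : c <= n -> size (key p c) = c.
Proof. by move=> cn; rewrite size_sort size_takel // size_tuple. Qed.

Lemma key_bound c y : y \in key p c -> 0 < y <= n.
Proof. by rewrite mem_key => /mem_take; rewrite mem_perm_iota. Qed.

Lemma key_subset c c' : c <= c' -> {subset key p c <= key p c'}.
Proof.
move=> cc' y; rewrite !mem_key => yc; have : y \in take c (take c' p) by rewrite take_takel.
exact: mem_take.
Qed.

Lemma key_le c c' : c' <= c -> col_le (key p c) (key p c').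
Proof. by move=> cc'; apply: col_le_subset; rewrite ?key_sorted //; apply: key_subset. Qed.

Lemma val_Ykey (j : 'I_ncols) (i : 'I_n) :
  Ykey lam p (j, i) = nth 0 (key p (collen j.+1)) i :> nat.
Proof. by rewrite val_of_cols //; apply/allP => y /key_bound/andP[]. Qed.

Lemma col_Ykey (j : 'I_ncols) : col (Ykey lam p) j = key p (collen j.+1).
Proof.
apply: (@eq_from_nth _ 0); first by rewrite size_col size_key ?collen_le_n.
by move=> i; rewrite size_col => ic; rewrite nth_col_ord val_Ykey.
Qed.

Lemma Ykey_tableau : Ykey lam p \in tableaux lam.
Proof.
have szk j : size (key p (collen j)) = collen j by rewrite size_key ?collen_le_n.
rewrite inE; apply/and3P; split.
- apply/forallP => j; apply/forallP => i; rewrite val_Ykey /in_shape.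
  case: (ltnP i (collen j.+1)) => ic; last by rewrite nth_default ?szk.
  have : nth 0 (key p (collen j.+1)) i \in key p (collen j.+1).
    by apply: nat_mem_nth; rewrite szk.
  by move/key_bound/andP => [->].
- apply/forallP => j; apply/forallP => i; apply/forallP => i'; apply/implyP.
  move=> /andP[ii' ic]; rewrite !val_Ykey.
  by apply: ltn_sorted_nth (key_sorted _) ii' _; rewrite szk.
apply/forallP => j; apply/forallP => j'; apply/forallP => i; apply/implyP.
move=> /andP[jj' ic]; rewrite !val_Ykey; apply: (key_le _).2; last by rewrite szk.
by apply: collen_anti; apply: ltnW.
Qed.

Lemma DsetP (T : filling lam) :
  reflect (T \in tableaux lam /\
           forall j : 'I_ncols, col_le (right_key_col T j) (key p (collen j.+1)))
          (T \in Dset lam p).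
Proof.
rewrite [T \in Dset _ _]inE; apply: (iffP andP) => -[TT H]; split=> //.
  move=> j; have [_ sR Rn _] := right_key_colP j TT.
  have szk : size (key p (collen j.+1)) = collen j.+1 by rewrite size_key ?collen_le_n.
  split=> [|i]; rewrite szk ?sR // => ic.
  move/forallP: H => /(_ (j, Ordinal (leq_trans ic (collen_le_n lam j.+1)))).
  by rewrite val_of_cols // val_Ykey.
apply/forallP => -[j i]; have [_ sR Rn _] := right_key_colP j TT.
rewrite val_of_cols // val_Ykey.
have szk : size (key p (collen j.+1)) = collen j.+1 by rewrite size_key ?collen_le_n.
case: (ltnP i (collen j.+1)) => ic; last by rewrite nth_default // sR.
by apply: (H j).2; rewrite szk.
Qed.

(** The columns of a key are nested, so a column on the right has no entry outside the bound and the
    last hypothesis of [jdt_exchange_bound] is vacuous. *)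
Lemma Ykey_Dset : Ykey lam p \in Dset lam p.
Proof.
apply/DsetP; split; first exact: Ykey_tableau.
move=> j; apply: right_key_col_inv; rewrite ?Ykey_tableau ?size_key ?collen_le_n //.
  by rewrite col_Ykey; split.
move=> A k jk As; rewrite ?col_Ykey => sA AD Ab.
apply: jdt_exchange_bound => //; rewrite ?key_sorted ?size_key ?collen_le_n //.
move=> i y _ yD; rewrite (key_subset _ yD) //.
by apply: collen_anti; apply: ltnW.
Qed.

End Permutation.

(** The key of [p] lies in the second set, so it is below its own right key, which is below the key
    of [p']. *)
Lemma Dset_key_le (p p' : n.-tuple nat) : perm_eq p (iota 1 n) -> perm_eq p' (iota 1 n) ->
  Dset lam p \subset Dset lam p' ->
  forall j : 'I_ncols, col_le (key p (collen j.+1)) (key p' (collen j.+1)).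
Proof.
move=> pP p'P /subsetP/(_ _ (Ykey_Dset pP))/(DsetP p'P)[TT H] j.
have [_ _ _] := right_key_colP j TT; rewrite col_Ykey // => le.
exact: col_le_trans le (H j).
Qed.

Lemma col_le_anti A B : col_le A B -> col_le B A -> A = B.
Proof.
move=> [sAB AB] [sBA BA].
have sz : size A = size B by apply/eqP; rewrite eqn_leq sAB sBA.
apply: (@eq_from_nth _ 0) => // i iA; apply/eqP.
by rewrite eqn_leq AB -?sz //= BA.
Qed.

(** Equal keys give equal sets B_h. Carrel by carrel, the entries are those of B_(h+1) outside B_h
    in increasing order, so the permutations agree. *)
Lemma Dset_inj (p p' : n.-tuple nat) : 0 < n -> Slam lam p -> Slam lam p' ->
  Dset lam p = Dset lam p' -> p = p'.
Proof.
move=> n_gt0 [pP pI] [p'P p'I] eqD.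
have kE (j : 'I_ncols) : key p (collen j.+1) = key p' (collen j.+1).
  by apply: col_le_anti; apply: Dset_key_le; rewrite // eqD.
have prefix h : h <= (r lam).+1 -> take (q lam h) p = take (q lam h) p'.
  elim: h => [|h IH] hr; first by rewrite q0 !take0.
  have pref := IH (ltnW hr); have lt_q : q lam h < q lam h.+1 by apply: q_lt.
  have q_n : q lam h.+1 <= n by apply: q_le_n.
  have peq : perm_eq (take (q lam h.+1) p) (take (q lam h.+1) p').
    have [h_r|h_r] : h < r lam \/ h = r lam by lia.
      have [j cj] := q_collen n_gt0 (h := h.+1) h_r; have := kE j; rewrite cj => e.
      by rewrite -(perm_sort leq) -/(key _ _) e perm_sort.
    (* On the last carrel no column is consulted: both prefixes are rearrangements of all of [n]. *)
    rewrite h_r q_last !take_oversize ?size_tuple //.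
    by rewrite (perm_trans pP) // perm_sym.
  have split_take (s : n.-tuple nat) :
      take (q lam h.+1) s = take (q lam h) s ++ drop (q lam h) (take (q lam h.+1) s).
    by rewrite -{1}(cat_take_drop (q lam h) (take _ s)) take_takel // ltnW.
  have slice (s : n.-tuple nat) : incr_on_carrels lam s ->
      sorted ltn (drop (q lam h) (take (q lam h.+1) s)).
    move=> sI; apply/(sortedP 0) => i.
    rewrite size_drop size_takel ?size_tuple // => ilt.
    rewrite !nth_drop !nth_take; try lia.
    have := sI (q lam h + i).+1 (q lam h + i.+1).+1; rewrite /ent /=; apply; try lia.
    by rewrite !(@carrel_eq _ _ n_gt0 _ h.+1) //=; lia.
  move: peq; rewrite (split_take p) (split_take p') pref perm_cat2l => peq.
  by congr cat; apply: ltn_sorted_eq; [apply: slice | apply: slice | apply: perm_mem].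
have := prefix _ (leqnn _); rewrite q_last !take_oversize ?size_tuple //.
by move=> e; apply: val_inj.
Qed.

End Columns.

(** * 312-avoiding permutations *)

Lemma sort_geq_rev (s : seq nat) : sort geq s = rev (sort leq s).
Proof.
apply: (@sorted_eq _ geq).
- by move=> x y z /= yx zy; apply: leq_trans zy yx.
- by move=> x y /=; lia.
- by apply: sort_sorted => x y; apply: leq_total.
- by rewrite rev_sorted; apply: sort_sorted; apply: leq_total.
- by rewrite perm_sort perm_sym perm_rev perm_sort.
Qed.

Lemma kth_largestE k s : 0 < k <= size s ->
  kth_largest k s = nth 0 (sort leq s) (size s - k).
Proof.
move=> ks; rewrite /kth_largest /ent sort_geq_rev nth_rev size_sort; last by lia.
by congr nth; lia.
Qed.

Lemma ent_mktuple n (f : 'I_n -> nat) (k : 'I_n) : [tuple f i | i < n] \_ k.+1 = f k.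
Proof. by rewrite /ent /= (nth_map k) ?size_enum_ord // nth_ord_enum. Qed.

Lemma ex_ord_succ n i : 0 < i <= n -> exists k : 'I_n, i = k.+1.
Proof. by case: i => // i ilt; exists (Ordinal ilt). Qed.

Lemma eq_from_ent n (a b : n.-tuple nat) :
  (forall i, 0 < i <= n -> a \_ i = b \_ i) -> a = b.
Proof.
move=> ab; apply: val_inj; apply: (@eq_from_nth _ 0); rewrite ?size_tuple //.
by move=> i ilt; apply: (ab i.+1).
Qed.

Section Avoiding.

Variables (n : nat) (lam : n.-tuple nat).
Hypothesis n_gt0 : 0 < n.

Local Notation q := (q lam).
Local Notation r := (r lam).
Local Notation carrel := (carrel lam).
Local Notation collen := (collen lam).
Local Notation ncols := (ncols lam).
Local Notation col := Defs.col.

(** The (q_h - i + 1)-th largest of q_h elements is the i-th smallest, so [Psi] reads row [i] of a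
    key column. *)
Lemma Psi_ent (p : n.-tuple nat) i : 0 < i <= n ->
  Psi lam p \_ i = nth 0 (key p (q (carrel i))) i.-1.
Proof.
move=> i_n; have [c cl ch] := carrelP lam n_gt0 i_n.
have [k ki] := ex_ord_succ i_n; subst i; rewrite ent_mktuple /Bset /=.
have q_n : q (carrel k.+1) <= n by apply: q_le_n; case/andP: c.
have szB : size (take (q (carrel k.+1)) p) = q (carrel k.+1).
  by rewrite size_takel ?size_tuple.
by rewrite kth_largestE szB /key; [congr nth|]; lia.
Qed.

Lemma mem_take_ent (p : n.-tuple nat) k c :
  uniq p -> 0 < c <= n -> (p \_ c \in take k p) = (c <= k).
Proof.
move=> up c_n; have cp : c.-1 < size p by rewrite size_tuple; lia.
by rewrite in_take ?mem_nth // index_uniq //; lia.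
Qed.

Lemma mem_ent (p : n.-tuple nat) y : y \in (p : seq nat) -> exists2 c, 0 < c <= n & p \_ c = y.
Proof. by case/mem_nat_nth => i; rewrite size_tuple => ilt <-; exists i.+1. Qed.

(** Let [x], [z], [y] stand at positions [a], [b], [c]. If [z] were not in B_h', then [b] would lie
    in a carrel after [h'], and the three positions would form a forbidden pattern. *)
Lemma avoids312_gapless (p : n.-tuple nat) h' h :
  Slam312 lam p -> 0 < h' -> h' <= h -> h <= r.+1 ->
  gapless (key p (q h')) (key p (q h)).
Proof.
move=> [[pP pI] av] h'0 h'h hr x y z xh' yh zh zy yx; have up := uniq_perm_iota pP.
have x_n := key_bound pP xh'; have z_n := key_bound pP zh.
have [c c_n yE] : exists2 c, 0 < c <= n & p \_ c = y.
  by apply: mem_ent; rewrite (mem_perm_iota pP); lia.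
move: xh' yh zh; rewrite !mem_key => xh' yh zh.
have [a a_n xE] := mem_ent (mem_take xh'); have [b b_n zE] := mem_ent (mem_take zh).
move: xh' yh zh; rewrite -xE -yE -zE !mem_take_ent // -ltnNge => a_h' c_h b_h.
rewrite leqNgt; apply/negP => h'_b; case: av; exists (carrel b).-1, a, b, c.
have [cb lb hb] := carrelP lam n_gt0 b_n.
have /andP[b0 _] := b_n.
have cbh : carrel b <= h by move: b_h; rewrite leq_carrel // => /andP[].
have h'cb : h' < carrel b.
  by rewrite ltnNge; apply/negP => le; have := q_le n_gt0 le (leq_trans h'h hr); lia.
(* Otherwise B_h would be all of [n], leaving no position for [y]. *)
have hlt : carrel b <= r.
  rewrite leqNgt; apply/negP => lt; have eh : h = r.+1 by lia.
  by move: c_h; rewrite eh q_last; lia.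
rewrite prednK; last by lia.
split; try lia.
- have := @q_le n lam n_gt0 h' (carrel b).-1; lia.
- have := @q_le n lam n_gt0 (carrel b) h; lia.
Qed.

Lemma Sset_PsiE (p : n.-tuple nat) : Slam312 lam p -> Sset lam (Psi lam p) = Dset lam p.
Proof.
move=> p312; have [[pP _] _] := p312; apply/setP => T.
(* Column lengths are carrel ends, so the carrel of a row of column [j] ends no lower than the
   column does. *)
have PsiE (j : 'I_ncols) i : i < collen j.+1 ->
    [/\ Psi lam p \_ i.+1 = nth 0 (key p (q (carrel i.+1))) i, 0 < carrel i.+1,
        q (carrel i.+1) <= collen j.+1, i < q (carrel i.+1)
      & gapless (key p (q (carrel i.+1))) (key p (collen j.+1))].
  move=> ic; have [h /andP[h0 hr] ch] := collen_q n_gt0 j; rewrite ch in ic *.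
  have i_n : 0 < i.+1 <= n by rewrite /= (leq_trans ic) // q_le_n.
  have [c _ ich] := carrelP lam n_gt0 i_n.
  have cih : carrel i.+1 <= h by move: ic; rewrite leq_carrel // => /andP[].
  split; rewrite ?Psi_ent //; first exact: q_le.
  by apply: avoids312_gapless => //; case/andP: c.
have szk (j : 'I_ncols) : size (key p (collen j.+1)) = collen j.+1.
  by rewrite size_key ?collen_le_n.
apply/SsetP/(DsetP pP) => -[TT H]; split=> // j.
  have [Ts _ _] := tableauxP TT.
  (* The row bounds first yield T <= Y(pi); only then are the columns exchanged. *)
  have Tle k : col_le (col T k) (key p (collen k.+1)).
    apply: col_le_gapless; rewrite ?key_sorted ?size_col // => i; rewrite szk => ic.
    have [PE _ qc iq gap] := PsiE _ _ ic; exists (key p (q (carrel i.+1))).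
    split; rewrite ?key_sorted //; first exact: key_subset.
      by rewrite size_key // (leq_trans qc) ?collen_le_n.
    by rewrite -PE H.
  apply: right_key_col_inv => // A k jk As; rewrite szk => sA AT Ab.
  have ckj : collen k.+1 <= collen j.+1 by apply: collen_anti; apply: ltnW.
  apply: (@jdt_exchange_gapless _ _ _ (key p (collen k.+1)));
    rewrite ?key_sorted ?szk ?size_col //.
    exact: key_subset.
  have [h' /andP[h'0 h'r] ch'] := collen_q n_gt0 k.
  have [h /andP[h0 hr] ch] := collen_q n_gt0 j.
  rewrite ch ch' in ckj *; apply: avoids312_gapless => //.
  rewrite leqNgt; apply/negP => lt; have := q_lt n_gt0 lt h'r; lia.
(* Conversely T <= K_+(T) <= Y(pi), and passing to a shorter prefix of [p] can only raise the
   entries of a key column. *)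
move=> i ic; have [PE _ qc iq _] := PsiE _ _ ic; rewrite PE.
have [_ sR _ TR] := right_key_colP j TT.
apply: leq_trans (TR.2 i _) _; first by rewrite sR.
apply: leq_trans ((H j).2 i _) _; first by rewrite szk.
apply: (key_le pP qc).2; rewrite size_key //; apply: leq_trans qc _.
exact: collen_le_n.
Qed.

End Avoiding.

(** * Critical indices *)

(* The recursion for the critical indices of a carrel ending at [hi] visits the
   strict records of the sequence b_y - y, read from the right. *)
Definition critical (b : seq nat) (hi x : nat) : bool :=
  all (fun y => b \_ x + (y - x) < b \_ y) (iota x.+1 (hi - x)).

Lemma criticalP b hi x :
  reflect (forall y, x < y -> y <= hi -> b \_ x + (y - x) < b \_ y) (critical b hi x).
Proof.
apply: (iffP allP) => [H y xy yhi|H y]; first by apply: H; rewrite mem_iota; lia.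
by rewrite mem_iota => y_iota; apply: H; lia.
Qed.

Lemma leq_last_ltn_sorted x y s : sorted ltn (y :: s) -> x \in y :: s -> x <= last y s.
Proof.
move=> ss /mem_nat_nth[i ilt <-]; rewrite (last_nth 0).
by apply: ltn_sorted_leq_nth.
Qed.

(** The next index [x'] is the largest candidate. No index strictly between [x'] and [x] is
    critical, being no candidate, and up to [x'] being critical for [x] is the same as being
    critical for [x']. *)
Lemma crit_chainE fuel b lo x : lo < x -> x - lo <= fuel.+1 ->
  crit_chain fuel b lo x = rev [seq y <- iota lo.+1 (x - lo) | critical b x y].
Proof.
elim: fuel x => [|fuel IH] x lox xf.
  have -> : x = lo.+1 by lia.
  by rewrite subSnn /= /critical subnn.
have -> : iota lo.+1 (x - lo) = iota lo.+1 (x.-1 - lo) ++ [:: x].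
  have -> : x - lo = (x.-1 - lo) + 1 by lia.
  by rewrite iotaD; congr cat; congr cons; lia.
have crx : critical b x x by rewrite /critical subnn.
rewrite filter_cat rev_cat /= crx /=; congr cons.
have cs : sorted ltn (crit_candidates b lo x).
  by apply: sorted_filter; [apply: ltn_trans | apply: iota_ltn_sorted].
have cmem (y : nat) : (y \in crit_candidates b lo x) =
    [&& b \_ y + (x - y) < b \_ x, lo < y & y < x].
  by rewrite mem_filter mem_iota; congr andb; lia.
case E: (crit_candidates _ _ _) cs cmem => [|y ys] cs cmem.
  rewrite (@eq_in_filter _ _ pred0) ?filter_pred0 // => y; rewrite mem_iota => y_iota.
  apply/negbTE/criticalP => /(_ x) H; have := cmem y; rewrite in_nil.
  by rewrite H; lia.
set x' := last y ys.
have : x' \in y :: ys by apply: mem_last.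
rewrite cmem => /and3P[x'x lox' ltx'].
have max z : b \_ z + (x - z) < b \_ x -> lo < z -> z < x -> z <= x'.
  move=> h1 h2 h3; apply: leq_last_ltn_sorted cs _; by rewrite cmem h1 h2 h3.
rewrite IH //; last by lia.
have -> : iota lo.+1 (x.-1 - lo) = iota lo.+1 (x' - lo) ++ iota x'.+1 (x.-1 - x').
  have -> : x.-1 - lo = (x' - lo) + (x.-1 - x') by lia.
  by rewrite iotaD; congr cat; congr iota; lia.
rewrite filter_cat [X in _ ++ X](@eq_in_filter _ _ pred0); last first.
  move=> z; rewrite mem_iota => z_iota; apply/negbTE/criticalP => /(_ x) H.
  by have := max z; lia.
rewrite filter_pred0 cats0; congr rev; apply: eq_in_filter => z; rewrite mem_iota => z_iota.
(* For x' < w <= x one has b_w - w >= b_x - x > b_x' - x' >= b_z - z, so the comparisons up to [x']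
   suffice. *)
apply/criticalP/criticalP => H w zw wx; last by apply: H; lia.
have [wx'|x'w] := leqP w x'; first exact: H.
have zx' : b \_ z + (x' - z) <= b \_ x'.
  have [->|ne] := eqVneq z x'; first by rewrite subnn addn0.
  by apply/ltnW/H; lia.
have [->|ne] := eqVneq w x; first by lia.
by have := max w; lia.
Qed.

Lemma sorted_map_ltn_sorted (f : nat -> nat) s : sorted ltn s ->
  reflect (forall x y, x \in s -> y \in s -> x < y -> f x <= f y)
          (sorted leq [seq f x | x <- s]).
Proof.
rewrite (sorted_pairwise ltn_trans) (sorted_pairwise leq_trans) pairwise_map.
elim: s => [|z s IH] /=; first by move=> _; left.
case/andP=> /allP zs /IH sP; apply: (iffP andP) => [[/allP fz /sP fs]|H]; last first.
  split; last by apply/sP => x y xs ys; apply: H; rewrite inE ?xs ?ys orbT.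
  by apply/allP => y ys; apply: H (zs y ys); rewrite inE ?eqxx ?ys ?orbT.
move=> x y; rewrite !inE => /predU1P[->|xs] /predU1P[->|ys] //.
- by move=> _; apply: fz.
- by move=> xz; have := zs x xs; rewrite /= ltnNge ltnW.
exact: fs.
Qed.

Section Critical.

Variables (n : nat) (lam : n.-tuple nat).
Hypothesis n_gt0 : 0 < n.

Local Notation q := (q lam).
Local Notation r := (r lam).
Local Notation carrel := (carrel lam).
Local Notation collen := (collen lam).

Lemma carrel_critsE b h : 0 < h -> h <= r.+1 -> carrel_crits lam b h =
  [seq y <- iota (q h.-1).+1 (q h - q h.-1) | critical b (q h) y].
Proof.
move=> h0 hr; rewrite /carrel_crits crit_chainE ?revK //.
  by apply: q_lt => //; lia.
by have := q_le_n n_gt0 hr; lia.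
Qed.

Lemma critsE b :
  crits lam b = [seq x <- iota 1 n | critical b (q (carrel x)) x].
Proof.
have prefix m : m <= r.+1 -> flatten [seq carrel_crits lam b h | h <- iota 1 m] =
    [seq x <- iota 1 (q m) | critical b (q (carrel x)) x].
  elim: m => // m IH mr; have lt_q : q m < q m.+1 by apply: q_lt.
  have -> : iota 1 m.+1 = iota 1 m ++ [:: m.+1] by rewrite -(addn1 m) iotaD add1n addn1.
  have -> : iota 1 (q m.+1) = iota 1 (q m) ++ iota (q m).+1 (q m.+1 - q m).
    by rewrite -{1}(subnKC (ltnW lt_q)) iotaD add1n.
  rewrite map_cat flatten_cat IH 1?ltnW //= cats0 filter_cat carrel_critsE //.
  congr cat; apply: eq_in_filter => x; rewrite mem_iota /= => x_iota.
  by rewrite (@carrel_eq _ _ n_gt0 x m.+1) //=; lia.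
by rewrite /crits prefix // q_last.
Qed.

Lemma UGCP (b : n.-tuple nat) : UGC lam b <-> U b /\
  forall x y, 0 < x -> x < y -> y <= n ->
    critical b (q (carrel x)) x -> critical b (q (carrel y)) y -> b \_ x <= b \_ y.
Proof.
rewrite /UGC critsE.
have ss : sorted ltn [seq x <- iota 1 n | critical b (q (carrel x)) x].
  by apply: sorted_filter; [apply: ltn_trans | apply: iota_ltn_sorted].
split=> -[Ub H]; split=> //.
  move=> x y x0 xy yn cx cy.
  by apply: (sorted_map_ltn_sorted (ent b) ss H) => //;
    rewrite mem_filter ?cx ?cy mem_iota; lia.
apply/(sorted_map_ltn_sorted _ ss) => x y; rewrite !mem_filter !mem_iota.
move=> /andP[cx xn] /andP[cy yn] xy; apply: H => //; lia.
Qed.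

Lemma UF_UGC (b : n.-tuple nat) : UF b -> UGC lam b.
Proof.
move=> [Ub bs]; apply/UGCP; split=> // x y x0 xy yn _ _.
by apply: (sorted_leq_nth leq_trans leqnn) => //; rewrite ?inE ?size_tuple; lia.
Qed.

(** The index [x] in [Delta]. For [i] in [n] the default [0] is never reached, since the end of a
    carrel is critical. *)
Definition next_critical (b : seq nat) (i : nat) : nat :=
  head 0 [seq x <- carrel_crits lam b (carrel i) | i <= x].

Lemma next_criticalP b i (x := next_critical b i) : 0 < i <= n ->
  [/\ i <= x <= q (carrel i), carrel x = carrel i, critical b (q (carrel i)) x
    & forall y, i <= y -> y <= q (carrel i) -> critical b (q (carrel i)) y -> x <= y].
Proof.
move=> i_n; have [/andP[c0 cr] cl ch] := carrelP lam n_gt0 i_n.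
rewrite /x /next_critical carrel_critsE //.
set s := [seq x <- _ | _].
have smem (y : nat) : (y \in s) = [&& i <= y, critical b (q (carrel i)) y & y <= q (carrel i)].
  rewrite /s !mem_filter mem_iota; case: (leqP i y) => // iy; congr (_ && (_ && _)); lia.
have ss : sorted ltn s.
  by do 2!(apply: sorted_filter; first exact: ltn_trans); apply: iota_ltn_sorted.
have : q (carrel i) \in s.
  by rewrite smem ch leqnn andbT /=; apply/criticalP => y; lia.
case: s ss smem => // z s ss smem _ /=.
have : z \in z :: s by rewrite mem_head.
rewrite smem => /and3P[iz cz zq]; split=> //; first by rewrite iz.
  by apply: carrel_eq => //; lia.
move=> y iy yq cy; have : y \in z :: s by rewrite smem iy cy.
rewrite inE => /predU1P[->//|ys].
by apply: ltnW; apply: (allP (order_path_min ltn_trans ss)).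
Qed.

Lemma next_critical_le b i : 0 < i <= n -> i <= next_critical b i <= n.
Proof.
move=> i_n; have [/andP[c0 cr] cl ch] := carrelP lam n_gt0 i_n.
have [/andP[ix xq] _ _ _] := next_criticalP b i_n.
by rewrite ix (leq_trans xq) ?q_le_n.
Qed.

Lemma next_critical_mono b i j : 0 < i -> i <= j -> j <= n ->
  next_critical b i <= next_critical b j.
Proof.
move=> i0 ij jn; have i_n : 0 < i <= n by lia.
have j_n : 0 < j <= n by lia.
have [ix cx Cx xmin] := next_criticalP b i_n.
have [jx cy Cy ymin] := next_criticalP b j_n.
have := carrel_le lam n_gt0 i0 ij jn; rewrite leq_eqVlt => /predU1P[e|lt].
  by rewrite e in xmin; apply: xmin => //; lia.
have [/andP[c0 cr] cl ch] := carrelP lam n_gt0 i_n.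
have [/andP[d0 dr] dl dh] := carrelP lam n_gt0 j_n.
have : q (carrel i) <= q (carrel j).-1 by apply: q_le => //; lia.
lia.
Qed.

Lemma next_critical_id b i : 0 < i <= n -> critical b (q (carrel i)) i ->
  next_critical b i = i.
Proof.
move=> i_n ci; have [/andP[ix xq] _ _ xmin] := next_criticalP b i_n.
have [_ _ ch] := carrelP lam n_gt0 i_n.
by apply/eqP; rewrite eqn_leq ix xmin.
Qed.

(** Equivalently, [Delta] does not increase entries. A non-critical [i] has a later [z] with b_z - z
    <= b_i - i. If [z] is past the next critical index, criticality of that index concludes;
    otherwise [z] has the same next critical index and induction applies. *)
Lemma next_critical_gap b i : 0 < i <= n ->
  b \_ (next_critical b i) <= b \_ i + (next_critical b i - i).
Proof.
have [m] := ubnP (n - i); elim: m i => // m IH i im i_n.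
have [/andP[ix xq] cx Cx xmin] := next_criticalP b i_n.
set x := next_critical b i in ix xq cx Cx xmin *.
have [/andP[c0 cr] cl ch] := carrelP lam n_gt0 i_n.
have qn : q (carrel i) <= n by apply: q_le_n.
have [ci|nci] := boolP (critical b (q (carrel i)) i).
  by rewrite /x next_critical_id // subnn addn0.
have ltx : i < x.
  by rewrite ltn_neqAle ix andbT; apply: contraNneq nci => e; move: Cx; rewrite -e.
have [z /andP[iz zq] bz] : exists2 z, i < z <= q (carrel i) & b \_ z <= b \_ i + (z - i).
  have [z] := allPn nci; rewrite mem_iota -leqNgt => z_iota bz.
  by exists z => //; lia.
have [zx|xz] := leqP z x; last first.
  by have := criticalP _ _ _ Cx z xz zq; lia.
have z_n : 0 < z <= n by lia.
have cz : carrel z = carrel i by apply: carrel_eq => //; lia.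
have nz : next_critical b z = x.
  have [/andP[zx' x'q] _ Cx' zmin] := next_criticalP b z_n.
  rewrite cz in x'q Cx' zmin.
  by apply/eqP; rewrite eqn_leq zmin //= xmin //; lia.
have := IH z; rewrite nz => /(_ _ z_n); lia.
Qed.

Lemma Delta_ent (b : n.-tuple nat) i : 0 < i <= n ->
  Delta lam b \_ i = b \_ (next_critical b i) - (next_critical b i - i).
Proof. by move=> /ex_ord_succ[k ->]; rewrite ent_mktuple. Qed.

(** Columns are strict, so a bound in row [x] gives a bound smaller by [x - i] in row [i]. Row [x]
    belongs to the same column because columns end where carrels do. *)
Lemma Sset_sub (b c : n.-tuple nat) :
  (forall i, 0 < i <= n -> exists2 x, i <= x <= q (carrel i) & b \_ x - (x - i) <= c \_ i) ->
  Sset lam b \subset Sset lam c.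
Proof.
move=> H; apply/subsetP => T /SsetP[TT Tb]; apply/SsetP; split=> // j i ic.
have [Ts _ _] := tableauxP TT.
have [h /andP[h0 hr] ch] := collen_q n_gt0 j.
have i_n : 0 < i.+1 <= n by have := collen_le_n lam j.+1; lia.
have [x /andP[ix xq]] := H i.+1 i_n; apply: leq_trans.
have xc : x.-1 < collen j.+1.
  have : carrel i.+1 <= h by move: ic; rewrite ch leq_carrel // => /andP[].
  by move=> cih; have := q_le n_gt0 cih hr; rewrite ch; lia.
have run k : i + k < collen j.+1 ->
    nth 0 (Defs.col T j) i + k <= nth 0 (Defs.col T j) (i + k).
  elim: k => [|k IH] ikc; first by rewrite !addn0.
  have lt : nth 0 (Defs.col T j) (i + k) < nth 0 (Defs.col T j) (i + k.+1).
    by apply: ltn_sorted_nth (Ts j) _ _; [lia | rewrite size_col].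
  by have := IH; lia.
have h1 := Tb j x.-1 xc; rewrite prednK in h1; last by lia.
have := run (x - i.+1); have -> : i + (x - i.+1) = x.-1 by lia.
by move=> /(_ xc) h2; lia.
Qed.

(** One inclusion takes [x = i], as [Delta] lowers entries; the other takes the next critical index,
    from which [Delta] computes its entry. *)
Lemma Sset_Delta (b : n.-tuple nat) : Sset lam (Delta lam b) = Sset lam b.
Proof.
apply/eqP; rewrite eqEsubset; apply/andP; split; apply: Sset_sub => i i_n.
  have [_ _ ch] := carrelP lam n_gt0 i_n.
  exists i; rewrite ?leqnn // Delta_ent //; have := next_critical_gap b i_n; lia.
have [ix _ _ _] := next_criticalP b i_n.
by exists (next_critical b i); rewrite ?Delta_ent.
Qed.

(** The flag for part (iii): constant between consecutive critical indices, hence weakly increasing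
    as soon as the critical entries are. *)
Definition ceiling (b : n.-tuple nat) : n.-tuple nat :=
  [tuple b \_ (next_critical b (val k).+1) | k < n].

Lemma ceiling_ent b i : 0 < i <= n -> ceiling b \_ i = b \_ (next_critical b i).
Proof. by move=> /ex_ord_succ[k ->]; rewrite ent_mktuple. Qed.

Lemma ceiling_UF b : UGC lam b -> UF (ceiling b).
Proof.
move=> /UGCP[[bn bU] bc]; split; first split=> i i_n.
- by have := next_critical_le b i_n; rewrite ceiling_ent // => x_n; apply: bn; lia.
- rewrite ceiling_ent //; have := next_critical_le b i_n => x_n.
  by apply: leq_trans (bU _ _); lia.
apply/(sortedP 0) => i; rewrite size_tuple => ilt.
rewrite -[nth _ _ i]/(ceiling b \_ i.+1) -[nth _ _ i.+1]/(ceiling b \_ i.+2).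
rewrite !ceiling_ent //; last by lia.
have := next_critical_mono b (ltn0Sn i) (leqnSn i.+1) ilt.
rewrite leq_eqVlt => /predU1P[->//|lt].
have i_n : 0 < i.+1 <= n by lia.
have i1_n : 0 < i.+2 <= n by lia.
have [_ c1 C1 _] := next_criticalP b i_n.
have [_ c2 C2 _] := next_criticalP b i1_n.
have := next_critical_le b i_n; have := next_critical_le b i1_n.
by move=> x2 x1; apply: bc; rewrite ?c1 ?c2 //; lia.
Qed.

(** Raising an entry to the next critical one loses nothing: strictness of columns recovers the
    bound from the critical row, where [b] and [ceiling b] agree. *)
Lemma Sset_ceiling b : UI lam b -> Sset lam (ceiling b) = Sset lam b.
Proof.
move=> [_ bI]; apply/eqP; rewrite eqEsubset; apply/andP.
split; apply: Sset_sub => i i_n.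
  have [ix cx Cx _] := next_criticalP b i_n; exists (next_critical b i) => //.
  have x_n := next_critical_le b i_n.
  rewrite ceiling_ent; last by lia.
  rewrite next_critical_id ?cx //; last by lia.
  by have := next_critical_gap b i_n; lia.
have [_ _ ch] := carrelP lam n_gt0 i_n.
exists i; rewrite ?leqnn // subnn subn0 ceiling_ent //.
have [ix cx _ _] := next_criticalP b i_n; have x_n := next_critical_le b i_n.
have [e|ne] := eqVneq i (next_critical b i); first by rewrite -e.
by apply/ltnW/bI; rewrite ?cx //; lia.
Qed.

End Critical.

(** * The images of [Psi] and [Delta] *)

Section Gapless.

Variables (n : nat) (lam : n.-tuple nat).
Hypothesis n_gt0 : 0 < n.

Local Notation q := (q lam).
Local Notation r := (r lam).
Local Notation carrel := (carrel lam).

Lemma leq_nth_ltn_sorted s i :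
  sorted ltn s -> (forall y, y \in s -> 0 < y) -> i < size s -> i < nth 0 s i.
Proof.
move=> ss s0; elim: i => [|i IH] ilt; first by apply/s0/nat_mem_nth.
by apply: leq_ltn_trans (IH (ltnW ilt)) _; apply: ltn_sorted_nth.
Qed.

(** Suppose Psi_x > Psi_y with [y] critical in a later carrel. Then Psi_y + 1 is missing from the
    set B of that carrel, and gaplessness puts the [y] smallest elements of B into the preceding
    set, which has fewer than [y] elements. *)
Lemma Psi_UG (p : n.-tuple nat) : Slam312 lam p -> UG lam (Psi lam p).
Proof.
move=> p312; have [[pP _] _] := p312.
have carrel_idx i : 0 < i <= n ->
    [/\ 0 < carrel i <= r.+1, q (carrel i) <= n & i.-1 < size (key p (q (carrel i)))].
  move=> i_n; have [c cl ch] := carrelP lam n_gt0 i_n.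
  have qn : q (carrel i) <= n by apply: q_le_n; case/andP: c.
  by rewrite size_key //; split=> //; lia.
have Psi_mem i : 0 < i <= n -> Psi lam p \_ i \in key p (q (carrel i)).
  by move=> i_n; rewrite Psi_ent //; apply: nat_mem_nth; have [] := carrel_idx i i_n.
have PsiU : U (Psi lam p).
  split=> i i_n; first exact: key_bound (Psi_mem i i_n).
  have [_ _ ilt] := carrel_idx i i_n; rewrite Psi_ent //.
  have := @leq_nth_ltn_sorted (key p (q (carrel i))) i.-1 (key_sorted pP _) _ ilt.
  by rewrite prednK; [apply=> y /(key_bound pP)/andP[] | case/andP: i_n].
have PsiI : incr_on_carrels lam (Psi lam p).
  move=> i j i0 ij jn cij; have j_n : 0 < j <= n by lia.
  have i_n : 0 < i <= n by lia.
  rewrite !Psi_ent // cij; have [_ _ jlt] := carrel_idx j j_n.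
  by apply: ltn_sorted_nth (key_sorted pP _) _ _ => //; lia.
split; last by split.
apply/UGCP => //; split=> // x y x0 xy yn cx cy.
have x_n : 0 < x <= n by lia.
have y_n : 0 < y <= n by lia.
have := carrel_le lam n_gt0 x0 (ltnW xy) yn; rewrite leq_eqVlt => /predU1P[e|lt].
  exact/ltnW/PsiI.
have [/andP[c0 cr] cl ch] := carrelP lam n_gt0 y_n.
have [/andP[cx0 _] _ _] := carrel_idx x x_n.
have [_ qn ylt] := carrel_idx y y_n.
pose g := (carrel y).-1; have gr : g <= r.+1 by lia.
have qgn : q g <= n by apply: q_le_n.
have xg : Psi lam p \_ x \in key p (q g).
  by apply: key_subset (Psi_mem x x_n); apply: q_le; rewrite // /g; lia.
have sub : {subset key p (q g) <= key p (q (carrel y))}.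
  by apply: key_subset; apply: q_le; rewrite // /g; lia.
rewrite leqNgt; apply/negP => lt_yx.
have [k kb kE] := mem_nat_nth (sub _ xg).
have yk : y.-1 < k.
  by apply: (ltn_sorted_nth_inv (key_sorted pP (q (carrel y)))) => //; rewrite kE -Psi_ent.
rewrite size_key // in kb.
(* B has an element above Psi_y, so row [y.+1] is still in the carrel, and criticality of [y] makes
   the entry jump by more than one there. *)
have y1_n : 0 < y.+1 <= n by lia.
have cy1 : carrel y.+1 = carrel y by apply: carrel_eq => //; lia.
have := criticalP _ _ _ cy y.+1 (leqnn _); rewrite subSnn addn1 => gapy.
have {}gapy : (Psi lam p \_ y).+1 < Psi lam p \_ y.+1 by apply: gapy; lia.
have uy : (Psi lam p \_ y).+1 \notin key p (q (carrel y)).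
  apply/negP => /mem_nat_nth[m mb mE]; rewrite !Psi_ent // cy1 in gapy mE.
  have sk := key_sorted pP (q (carrel y)); rewrite size_key // in mb.
  have ym : y.-1 < m.
    by apply: (ltn_sorted_nth_inv sk) => //; rewrite mE.
  have my : m < y.+1.-1.
    by apply: (ltn_sorted_nth_inv sk); rewrite ?mE // size_key.
  lia.
have xu : (Psi lam p \_ y).+1 < Psi lam p \_ x.
  rewrite ltn_neqAle lt_yx andbT; apply: contraNneq uy => ->; exact: sub.
have gap : gapless (key p (q g)) (key p (q (carrel y))).
  by apply: avoids312_gapless => //; rewrite /g; lia.
have [] := gapless_rank (key_sorted pP _) (key_sorted pP _) gap xg uy xu ylt.
  by rewrite -Psi_ent.
rewrite size_key // /g; lia.
Qed.

(** With [UI], this is what the analysis of [Pi] needs: the integers from the first entry of a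
    carrel up to the last entry of the preceding one open the carrel as a run. *)
Definition overlap_runs (d : seq nat) : Prop :=
  forall h t, 0 < h <= r -> d \_ (q h).+1 + t <= d \_ (q h) ->
    (q h).+1 + t <= q h.+1 /\ d \_ ((q h).+1 + t) = d \_ (q h).+1 + t.

(** Indices with the same next critical index get consecutive values; otherwise the critical
    inequality between the two next critical indices gives the strict increase. *)
Lemma Delta_UI (b : n.-tuple nat) : U b -> UI lam (Delta lam b).
Proof.
move=> [bn bU]; split; first split=> i i_n.
- have x_n := next_critical_le lam n_gt0 b i_n; rewrite Delta_ent //.
  have := bn (next_critical lam b i); have := bU (next_critical lam b i); lia.
- have x_n := next_critical_le lam n_gt0 b i_n; rewrite Delta_ent //.
  have := bU (next_critical lam b i); lia.
move=> i j i0 ij jn cij; have i_n : 0 < i <= n by lia.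
have j_n : 0 < j <= n by lia.
rewrite !Delta_ent //.
have [/andP[ix xq] cx Cx xmin] := next_criticalP lam n_gt0 b i_n.
have [/andP[jy yq] cy Cy ymin] := next_criticalP lam n_gt0 b j_n.
have y_n := next_critical_le lam n_gt0 b j_n.
have x_n := next_critical_le lam n_gt0 b i_n.
have x_n' : 0 < next_critical lam b i <= n by lia.
have y_n' : 0 < next_critical lam b j <= n by lia.
have bi := bU _ x_n'; have bj := bU _ y_n'.
have := next_critical_mono lam n_gt0 b i0 (ltnW ij) jn.
rewrite leq_eqVlt => /predU1P[e|lt]; first by rewrite e; lia.
have := criticalP _ _ _ Cx _ lt; rewrite cij => /(_ yq).
have xj : next_critical lam b i < j.
  rewrite ltnNge; apply/negP => jx; rewrite -cij in ymin.
  by have := ymin _ jx xq Cx; lia.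
lia.
Qed.

(* The first critical entry of a carrel is at least the last entry of the
   preceding carrel, and [Delta b] is consecutive up to it. *)
Lemma Delta_overlap (b : n.-tuple nat) : UGC lam b -> overlap_runs (Delta lam b).
Proof.
move=> /(UGCP _ n_gt0)[[bn bU] bc] h t /andP[h0 hr].
have lt_q : q h < q h.+1 by apply: q_lt.
have qh0 : 0 < q h by apply: q_gt0 => //; lia.
have qn : q h.+1 <= n by apply: q_le_n.
have qh_n : 0 < q h <= n by lia.
have i_n : 0 < (q h).+1 <= n by lia.
have ch : carrel (q h) = h.
  by apply: carrel_eq; rewrite ?leqnn ?andbT //; [lia | apply: q_lt => //; lia].
have ci : carrel (q h).+1 = h.+1 by apply: carrel_eq => //=; lia.
have Ch : critical b (q (carrel (q h))) (q h) by rewrite ch; apply/criticalP => y; lia.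
have [/andP[ix xq] cx Cx xmin] := next_criticalP lam n_gt0 b i_n.
rewrite [Delta lam b \_ (q h)]Delta_ent // [Delta lam b \_ (q h).+1]Delta_ent //.
rewrite (next_critical_id n_gt0 qh_n Ch) subnn subn0.
set x := next_critical lam b (q h).+1 in ix xq cx Cx xmin *.
rewrite ci in cx Cx xq xmin *.
have xn : x <= n by lia.
have x_n : 0 < x <= n by lia.
have bx : b \_ (q h) <= b \_ x by apply: bc => //; rewrite cx.
have bxx := bU x x_n => le_t.
(* Values up to b_(q h) <= b_x are reached no later than [x], where the consecutive run ends. *)
have tx : (q h).+1 + t <= x by lia.
have t_n : 0 < (q h).+1 + t <= n by lia.
split; first by lia.
rewrite Delta_ent //.
have ct : carrel ((q h).+1 + t) = h.+1 by apply: carrel_eq => //=; lia.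
have [/andP[iy yq] cy Cy ymin] := next_criticalP lam n_gt0 b t_n.
rewrite ct in yq cy Cy ymin.
have -> : next_critical lam b ((q h).+1 + t) = x.
  by apply/eqP; rewrite eqn_leq ymin // xmin //; lia.
lia.
Qed.

End Gapless.

(** * The map Pi *)

Section PiStep.

Variables (p : seq nat) (d : nat -> nat) (qh q' : nat).
(** [M] bounds the prefix [p] and [L] opens the new carrel; [s] is the number of integers from [L]
    to [M]. *)
Let M := d qh.
Let L := d qh.+1.
Let s := if L <= M then M - L + 1 else 0.
Let pool : seq nat := [seq x <- iota 1 M | x \notin p].
Let new := [seq if i <= qh + s then kth_largest (qh + s - i + 1) pool else d i
           | i <- iota qh.+1 (q' - qh)].

Hypotheses (up : uniq p) (sp : size p = qh)
  (p_bound : forall y : nat, y \in p -> 0 < y <= M)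
  (lt_q : qh < q') (d_incr : forall i j, qh < i -> i < j -> j <= q' -> d i < d j)
  (L_gt : qh < L)
  (runs : forall t, L + t <= M -> qh.+1 + t <= q' /\ d (qh.+1 + t) = L + t).

Lemma overlapE : s = M.+1 - L.
Proof. by rewrite /s; case: (leqP L M) => LM; lia. Qed.

Lemma mem_pool y : (y \in pool) = (y \notin p) && (0 < y <= M).
Proof. by rewrite mem_filter mem_iota add1n ltnS. Qed.

Lemma pool_sorted : sorted ltn pool.
Proof. by apply: sorted_filter; [apply: ltn_trans | apply: iota_ltn_sorted]. Qed.

Lemma size_pool : size pool = M - qh.
Proof.
have := count_predC (mem p) (iota 1 M); rewrite size_iota -!size_filter => <-.
have -> : size [seq x <- iota 1 M | mem p x] = qh.
  rewrite -sp; apply/perm_size/uniq_perm; rewrite ?filter_uniq ?iota_uniq // => y.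
  rewrite mem_filter mem_iota add1n ltnS /=; apply: andb_idr; exact: p_bound.
by rewrite addKn.
Qed.

Lemma overlap_le : s <= size pool /\ qh + s <= q'.
Proof.
rewrite size_pool /s; case: (leqP L M) => LM; last by lia.
by have := @runs (M - L); lia.
Qed.

(** At most [s] elements of the pool are at least [L], so each is among the [s] largest. *)
Lemma pool_top y : y \in pool -> L <= y -> y \in drop (size pool - s) pool.
Proof.
move=> y_pool Ly; have yM : y <= M by move: y_pool; rewrite mem_pool => /and3P[].
have [i ilt iE] := mem_nat_nth y_pool.
have sub : {subset drop i pool <= iota L (M.+1 - L)}.
  move=> z /mem_nat_nth[k]; rewrite size_drop nth_drop => kl kE.
  have : z \in pool by rewrite -kE; apply: nat_mem_nth; lia.
  rewrite mem_pool mem_iota => /andP[_ zM].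
  have : y <= z by rewrite -iE -kE; apply: ltn_sorted_leq_nth pool_sorted _ _; lia.
  lia.
have := uniq_nat_leq_size (drop_uniq i (ltn_sorted_uniq pool_sorted)) sub.
rewrite size_drop size_iota => le.
have is_le : size pool - s <= i by rewrite overlapE; lia.
have -> : y = nth 0 (drop (size pool - s) pool) (i - (size pool - s)).
  by rewrite nth_drop subnKC.
by apply: nat_mem_nth; rewrite size_drop; lia.
Qed.

Let tail := [seq d i | i <- iota (qh + s).+1 (q' - qh - s)].

(** The descending ranks used by [Pi_prefix] list the [s] largest elements of the pool in increasing
    order. *)
Lemma newE : new = drop (size pool - s) pool ++ tail.
Proof.
have [s_pool qs] := overlap_le.
rewrite /new; have -> : iota qh.+1 (q' - qh) = iota qh.+1 s ++ iota (qh + s).+1 (q' - qh - s).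
  by rewrite -addSn -iotaD; congr iota; lia.
rewrite map_cat; congr cat; last first.
  by apply/eq_in_map => i; rewrite mem_iota => i_iota; rewrite leqNgt (_ : qh + s < i) //; lia.
apply: (@eq_from_nth _ 0); first by rewrite size_map size_iota size_drop; lia.
move=> i; rewrite size_map size_iota => ilt.
rewrite (nth_map 0) ?size_iota // nth_iota // (_ : qh.+1 + i <= qh + s); last by lia.
rewrite kth_largestE; last by lia.
rewrite (sorted_sort leq_trans); last first.
  by apply: sub_sorted pool_sorted => a b; apply: ltnW.
by rewrite nth_drop; congr nth; lia.
Qed.

Lemma mem_new z : z \in new -> z \in pool \/ z \in tail.
Proof. by rewrite newE mem_cat => /orP[/mem_drop|]; [left | right]. Qed.

(** If [L <= M], the run reaches the value [M] exactly at position [qh + s]; otherwise [s = 0] and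
    already [L] exceeds [M]. *)
Lemma mem_tail z : z \in tail -> exists i, [/\ qh + s < i, i <= q', z = d i & M < z].
Proof.
have [s_pool qs] := overlap_le.
case/mapP => i; rewrite mem_iota => i_iota ->; exists i; split=> //; try by lia.
have [LM|ML] := leqP L M; last first.
  apply: leq_trans ML _; rewrite /L; have [->//|ne] := eqVneq i qh.+1.
  by apply/ltnW/d_incr; lia.
have [] := @runs (M - L); first by lia.
have sE := overlapE.
move=> _ dE; rewrite -(subnKC LM) -dE; apply: d_incr; lia.
Qed.

Lemma new_sorted : sorted ltn new.
Proof.
have [s_pool qs] := overlap_le.
rewrite newE (sorted_pairwise ltn_trans) pairwise_cat; apply/and3P; split.
- apply/allrelP => x y /mem_drop; rewrite mem_pool => /andP[_ /andP[_ xM]].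
  by case/mem_tail => i [_ _ _]; apply: leq_ltn_trans.
- by rewrite -(sorted_pairwise ltn_trans); apply: drop_sorted pool_sorted.
rewrite -(sorted_pairwise ltn_trans); apply/(sortedP 0) => i.
rewrite size_map size_iota => ilt.
by rewrite !(nth_map 0) ?size_iota ?nth_iota; try lia; apply: d_incr; lia.
Qed.

Lemma size_new : size new = q' - qh.
Proof. by rewrite size_map size_iota. Qed.

Lemma cat_new_uniq : uniq (p ++ new).
Proof.
rewrite cat_uniq up (ltn_sorted_uniq new_sorted) andbT /=.
apply/hasPn => z /mem_new[|/mem_tail[i [_ _ _ Mz]]].
  by rewrite mem_pool => /andP[].
by apply/negP => /p_bound; lia.
Qed.

Let carrel_entries := [seq d i | i <- iota qh.+1 (q' - qh)].

Lemma carrel_entries_sorted : sorted ltn carrel_entries.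
Proof.
apply/(sortedP 0) => i; rewrite size_map size_iota => ilt.
by rewrite !(nth_map 0) ?size_iota ?nth_iota; try lia; apply: d_incr; lia.
Qed.

Lemma mem_overlap z : L <= z -> z <= M -> z \in carrel_entries.
Proof.
move=> Lz zM; have [] := @runs (z - L); first by lia.
rewrite (subnKC Lz) => le <-; apply: map_f; rewrite mem_iota; lia.
Qed.

(** The elements of [p ++ new] that are at least [L] are exactly the entries of [d] on the carrel:
    from [L] to [M] every integer occurs on both sides, as the missing ones are inserted from the
    pool, and above [M] only [tail] contributes. *)
Lemma drop_sort_cat_new : drop qh (sort leq (p ++ new)) = carrel_entries.
Proof.
have [s_pool qs] := overlap_le.
set S := sort leq (p ++ new).
have Ss : sorted ltn S by apply/sort_ltn_sorted/cat_new_uniq.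
have sS : size S = q' by rewrite size_sort size_cat size_new sp subnKC // ltnW.
have highE : [seq z <- S | L <= z] = carrel_entries.
  apply: ltn_sorted_eq.
  - by apply: sorted_filter => //; apply: ltn_trans.
  - exact: carrel_entries_sorted.
  move=> z; rewrite mem_filter mem_sort mem_cat; apply/andP/idP.
    case=> Lz /orP[/p_bound/andP[_]|]; first exact: mem_overlap.
    case/mem_new; first by rewrite mem_pool => /andP[_ /andP[_]]; apply: mem_overlap.
    by case/mem_tail => i [qi iq -> _]; apply: map_f; rewrite mem_iota; lia.
  case/mapP => i; rewrite mem_iota => i_iota ->.
  have Ldi : L <= d i.
    by rewrite /L; have [->//|ne] := eqVneq i qh.+1; apply/ltnW/d_incr; lia.
  split=> //; rewrite newE mem_cat.
  have [lt_i|le_i] := ltnP (qh + s) i.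
    apply/orP; right; apply/orP; right; apply: map_f; rewrite mem_iota; lia.
  have iE : i = qh.+1 + (i - qh.+1) by lia.
  have [] := @runs (i - qh.+1); first by move: le_i; rewrite overlapE; lia.
  rewrite -iE => _ dE; have diM : d i <= M by move: le_i; rewrite dE overlapE; lia.
  case: (boolP (d i \in p)) => //= dip; rewrite pool_top // mem_pool dip /=; lia.
have SE : S = [seq z <- S | z < L] ++ [seq z <- S | L <= z].
  apply: ltn_sorted_eq => //.
    rewrite (sorted_pairwise ltn_trans) pairwise_cat; apply/and3P; split.
    - apply/allrelP => x y; rewrite !mem_filter => /andP[xL _] /andP[Ly _].
      exact: leq_trans xL Ly.
    - by rewrite -(sorted_pairwise ltn_trans); apply: sorted_filter => //; apply: ltn_trans.
    - by rewrite -(sorted_pairwise ltn_trans); apply: sorted_filter => //; apply: ltn_trans.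
  by move=> z; rewrite mem_cat !mem_filter -andb_orl; case: ltnP.
rewrite SE highE drop_size_cat //.
(* By counting, exactly [qh] elements are below [L]. *)
have := congr1 size SE; rewrite highE size_cat sS size_map size_iota; lia.
Qed.

(** Restores the bound on the prefix for the next carrel. *)
Lemma cat_new_bound z : z \in p ++ new -> 0 < z <= d q'.
Proof.
move=> z_in; have z0 : 0 < z.
  move: z_in; rewrite mem_cat => /orP[/p_bound/andP[]//|/mem_new[]].
    by rewrite mem_pool => /and3P[].
  by case/mem_tail => i [_ _ _]; apply: leq_ltn_trans.
rewrite z0 /=; have Ldq : L <= d q'.
  by rewrite /L; have [->//|ne] := eqVneq qh.+1 q'; apply/ltnW/d_incr; lia.
have [zL|Lz] := ltnP z L; first by lia.
have : z \in carrel_entries.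
  move: z_in; rewrite mem_cat => /orP[/p_bound/andP[_]|/mem_new[]].
  - exact: mem_overlap.
  - by rewrite mem_pool => /andP[_ /andP[_]]; apply: mem_overlap.
  by case/mem_tail => i [qi iq -> _]; apply: map_f; rewrite mem_iota; lia.
case/mapP => i; rewrite mem_iota => i_iota ->.
by have [->//|ne] := eqVneq i q'; apply/ltnW/d_incr; lia.
Qed.

(** As [z] is below [M], it is one of the largest elements of the pool; a missing [y] above it would
    be in the pool and hence be inserted too. *)
Lemma new_gapless x y z : z \in new -> z < y -> y < x -> x \in p -> y \in p ++ new.
Proof.
move=> z_new zy yx /p_bound/andP[_ xM].
rewrite mem_cat; case: (boolP (y \in p)) => //= yp.
have y_pool : y \in pool by rewrite mem_pool yp; lia.
move: z_new; rewrite newE !mem_cat => /orP[z_top|/mem_tail[i [_ _ _]]]; last by lia.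
by rewrite (ltn_sorted_drop_mem pool_sorted z_top).
Qed.

End PiStep.

Section PiPsi.

Variables (n : nat) (lam g : n.-tuple nat).
Hypotheses (n_gt0 : 0 < n) (gUI : UI lam g) (g_runs : overlap_runs lam g).

Local Notation q := (q lam).
Local Notation r := (r lam).
Local Notation carrel := (carrel lam).
Local Notation P := (Pi_prefix lam g).

Let g_incr h i j : h <= r -> q h < i -> i < j -> j <= q h.+1 -> g \_ i < g \_ j.
Proof.
move=> hr qi ij jq; have jn : q h.+1 <= n by apply: q_le_n.
apply: gUI.2 => //; try by lia.
by rewrite !(@carrel_eq _ _ n_gt0 _ h.+1) //=; lia.
Qed.

Let g_gt h : h <= r -> q h < g \_ (q h).+1.
Proof.
move=> hr; have [[_ gU] _] := gUI; apply: gU.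
have : q h < q h.+1 by apply: q_lt.
by have := q_le_n (lam := lam) n_gt0 (h := h.+1) hr; lia.
Qed.

Let g_runs' h : h < r -> forall t, g \_ (q h.+1).+1 + t <= g \_ (q h.+1) ->
  (q h.+1).+1 + t <= q h.+2 /\ g \_ ((q h.+1).+1 + t) = g \_ (q h.+1).+1 + t.
Proof. by move=> hr t; apply: g_runs. Qed.

(** Iterates the one-carrel step; note that [P h] has length [q h.+1]. The bound feeds the next
    step, the sorted slice yields [Psi_Pi], and the last property is the increase on carrels. *)
Lemma Pi_prefixP h : h <= r ->
  [/\ size (P h) = q h.+1, uniq (P h), forall y, y \in P h -> 0 < y <= g \_ (q h.+1),
      drop (q h) (sort leq (P h)) =
        [seq g \_ i | i <- iota (q h).+1 (q h.+1 - q h)]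
    & sorted ltn (drop (q h) (P h))].
Proof.
elim: h => [|h IH] hr.
  have Ps : sorted ltn (P 0).
    apply/(sortedP 0) => i; rewrite size_map size_iota => ilt.
    rewrite !(nth_map 0) ?size_iota ?nth_iota; try lia.
    by apply: (@g_incr 0); rewrite ?q0; lia.
  rewrite !drop0 (sorted_sort leq_trans); last first.
    by apply: sub_sorted Ps => a b; apply: ltnW.
  split=> //; first by rewrite size_map size_iota.
  - exact: ltn_sorted_uniq.
  - move=> y /mapP[i]; rewrite mem_iota => i_iota ->.
    have q1n : q 1 <= n by apply: q_le_n.
    have [[gn gU] _] := gUI; have := gn i; have := g_incr (h := 0) (i := i) (j := q 1).
    have [->|ne] := eqVneq i (q 1); first by have := gn (q 1); rewrite leqnn; lia.
    rewrite q0; lia.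
  by rewrite q0 subn0.
have [sP uP bP _ _] := IH (ltnW hr).
have lt_q : q h.+1 < q h.+2 by apply: q_lt.
have incr := @g_incr h.+1; have gt := g_gt hr; have runs := g_runs' hr.
split.
- by rewrite /= size_cat size_map size_iota sP subnKC // ltnW.
- exact: (cat_new_uniq (d := ent g) uP sP bP lt_q (fun i j => @incr i j hr) gt runs).
- move=> y; exact: (cat_new_bound (d := ent g) uP sP bP lt_q (fun i j => @incr i j hr) gt runs).
- exact: (drop_sort_cat_new (d := ent g) uP sP bP lt_q (fun i j => @incr i j hr) gt runs).
rewrite /= drop_size_cat //.
exact: (new_sorted (d := ent g) uP sP bP lt_q (fun i j => @incr i j hr) gt runs).
Qed.

Lemma Pi_prefix_gapless h x y z : h < r ->
  z \in drop (q h.+1) (P h.+1) -> z < y -> y < x -> x \in P h -> y \in P h.+1.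
Proof.
move=> hr; have [sP uP bP _ _] := Pi_prefixP (ltnW hr).
have lt_q : q h.+1 < q h.+2 by apply: q_lt.
rewrite /= drop_size_cat //.
exact: (new_gapless (d := ent g) uP sP bP lt_q (fun i j => @g_incr h.+1 i j hr) (g_gt hr)
  (g_runs' hr)).
Qed.

Lemma tval_Pi : tval (Pi lam g) = P r.
Proof.
have [sP _ _ _ _] := Pi_prefixP (leqnn r); rewrite q_last in sP.
apply: (@eq_from_nth _ 0); rewrite ?size_tuple ?sP // => i ilt.
rewrite (nth_map (Ordinal ilt)) ?size_enum_ord //.
by rewrite (nth_enum_ord _ ilt).
Qed.

Lemma take_Pi h : h <= r -> take (q h.+1) (Pi lam g) = P h.
Proof.
rewrite tval_Pi; have pref k : h + k <= r -> take (q h.+1) (P (h + k)) = P h.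
  elim: k => [|k IH] hk.
    rewrite addn0 in hk *; have [sP _ _ _ _] := Pi_prefixP hk.
    by rewrite -sP take_size.
  rewrite addnS in hk *; have [sP _ _ _ _] := Pi_prefixP (ltnW hk).
  rewrite /= takel_cat ?IH ?(ltnW hk) // sP; apply: q_le => //; lia.
by move=> hr; have := pref (r - h); rewrite subnKC // => ->.
Qed.

Lemma Pi_ent_drop h i : h <= r -> q h < i -> i <= q h.+1 ->
  Pi lam g \_ i = nth 0 (drop (q h) (P h)) (i.-1 - q h).
Proof.
move=> hr qi iq; rewrite nth_drop -take_Pi // nth_take; last by lia.
by rewrite /ent; congr nth; lia.
Qed.

(** The word is a permutation because it has [n] distinct entries in [n]; 312-avoidance comes from
    gaplessness of each step. *)
Lemma Pi_Slam312 : Slam312 lam (Pi lam g).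
Proof.
have [sP uP bP _ _] := Pi_prefixP (leqnn r); rewrite q_last in sP bP.
have PP : perm_eq (Pi lam g) (iota 1 n).
  rewrite tval_Pi; apply: uniq_perm; rewrite ?iota_uniq //.
  have sub : {subset P r <= iota 1 n}.
    move=> y /bP y_n; have [[gn _] _] := gUI; rewrite mem_iota.
    by have := gn n; lia.
  by apply: (uniq_min_size uP sub _).2; rewrite sP size_iota.
have up := uniq_perm_iota PP.
have carrel_pred i : 0 < i <= n ->
    exists h, [/\ h <= r, q h < i, i <= q h.+1 & carrel i = h.+1].
  move=> i_n; have [/andP[c0 cr] cl ch] := carrelP lam n_gt0 i_n.
  by exists (carrel i).-1; rewrite prednK //; split=> //; lia.
split; first split=> //.
  move=> i j i0 ij jn cij.
  have [|h [hr qi iq ci]] := carrel_pred i; first by lia.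
  have [|h' [_ qj jq cj]] := carrel_pred j; first by lia.
  have e : h' = h by lia.
  subst h'; have [sPh _ _ _ Ps] := Pi_prefixP hr; rewrite !(Pi_ent_drop hr) //.
  by apply: ltn_sorted_nth Ps _ _; rewrite ?size_drop ?sPh; lia.
move=> [[|h] [a [b [c [/andP[// _ /ltnW hr] a_h /andP[qb bq] /andP[qc cn] /andP[bc ca]]]]]].
have qn : q h.+2 <= n by apply: q_le_n.
have qq : q h.+1 < q h.+2 by apply: q_lt => //; lia.
have a_mem : Pi lam g \_ a \in P h.
  by rewrite -(take_Pi (ltnW hr)) mem_take_ent //; lia.
have b_mem : Pi lam g \_ b \in drop (q h.+1) (P h.+1).
  have [sPh _ _ _ _] := Pi_prefixP hr; rewrite (Pi_ent_drop hr) //.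
  by apply: nat_mem_nth; rewrite size_drop sPh; lia.
(* This puts the entry at [c] into the prefix of length [q h.+2], although [c] is beyond it. *)
have := Pi_prefix_gapless hr b_mem bc ca a_mem.
by rewrite -(take_Pi hr) mem_take_ent //; lia.
Qed.

Lemma Psi_Pi : Psi lam (Pi lam g) = g.
Proof.
apply: eq_from_ent => i i_n; rewrite Psi_ent //.
have [/andP[c0 cr] cl ch] := carrelP lam n_gt0 i_n.
set h := (carrel i).-1 in cl; have hr : h <= r by rewrite /h; lia.
have cE : carrel i = h.+1 by rewrite /h; lia.
rewrite cE in ch *; rewrite /key take_Pi //.
have [sP uP bP dP _] := Pi_prefixP hr.
have -> : i.-1 = q h + (i.-1 - q h) by lia.
rewrite -nth_drop dP (nth_map 0) ?size_iota ?nth_iota; try by lia.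
by congr ent; lia.
Qed.

End PiPsi.

(** * Coincidence of flag Schur and Demazure polynomials *)

(** With delta = Delta(eta) and pi = Pi(delta), the chain is S(eta) = S(delta) = S(Psi(pi)) =
    D(pi). *)
Lemma UGC_Pi_Delta (n : nat) (lam eta : n.-tuple nat) :
  0 < n -> UGC lam eta -> let pi := Pi lam (Delta lam eta) in
  Slam312 lam pi /\ Sset lam eta = Dset lam pi.
Proof.
move=> n_gt0 etaC pi.
have dUI := Delta_UI lam n_gt0 etaC.1.
have runs := Delta_overlap n_gt0 etaC.
have pi312 : Slam312 lam pi := Pi_Slam312 n_gt0 dUI runs.
by split=> //; rewrite -(Sset_PsiE n_gt0 pi312) (Psi_Pi n_gt0 dUI runs) Sset_Delta.
Qed.

Theorem theorem10p2 (n : nat) (lam : n.-tuple nat)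
    (n_gt0 : 0 < n) (lamP : is_partition lam) :
  [/\ (forall eta : n.-tuple nat, UGC lam eta ->
         let pi := Pi lam (Delta lam eta) in
         Slam312 lam pi /\ identical (s_lam lam eta) (d_lam lam pi)),
      (forall pi : n.-tuple nat, Slam312 lam pi ->
         let gamma := Psi lam pi in
         UG lam gamma /\ identical (d_lam lam pi) (s_lam lam gamma)),
      (forall phi : n.-tuple nat, UF phi ->
         exists! pi : n.-tuple nat,
           Slam lam pi /\ identical (s_lam lam phi) (d_lam lam pi))
    & (forall pi : n.-tuple nat, Slam312 lam pi ->
         exists! P : {mpoly int[n]},
           exists phi : n.-tuple nat,
             [/\ UF phi, P = weight_poly (s_lam lam phi)
               & identical (d_lam lam pi) (s_lam lam phi)])].
Proof.
split.
- by move=> eta; apply: UGC_Pi_Delta.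
- move=> pi pi312 gamma; split; first exact: Psi_UG.
  by rewrite /identical /= Sset_PsiE.
- move=> phi phiF.
  have [[piS _] sE] := UGC_Pi_Delta n_gt0 (UF_UGC lam n_gt0 phiF).
  exists (Pi lam (Delta lam phi)); split=> // pi' [pi'S sE'].
  by apply: (Dset_inj n_gt0 piS pi'S); rewrite -sE.
move=> pi pi312; have [gC gI] := Psi_UG n_gt0 pi312.
(* [Psi lam pi] need not be weakly increasing; its ceiling is a flag bounding the same tableaux. *)
have sE : Sset lam (ceiling lam (Psi lam pi)) = Dset lam pi.
  by rewrite (Sset_ceiling n_gt0 gI) Sset_PsiE.
exists (weight_poly (s_lam lam (ceiling lam (Psi lam pi)))); split.
  by exists (ceiling lam (Psi lam pi)); split=> //; apply: ceiling_UF.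
(* It is the polynomial that is unique: different flags may bound the same tableaux, but flags
   identical to D(pi) share its support. *)
move=> P' [phi [_ -> sphi]]; rewrite /weight_poly /= sE.
by rewrite (sphi : Dset lam pi = Sset lam phi).
Qed.
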